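(* Let $A$ and $B$ be symmetrizable generalized Cartan matrices, and let $\Sigma$ be a linearly independent $\pi$-system of type $B$ in $A$. Suppose that $B$ is indecomposable. Then: (1) There exists $w\in W(A)$ such that $w\Sigma\subset \Delta^{re}_+(A)$ or $w\Sigma\subset\Delta^{re}_-(A)$. (2) There exist $w_1,w_2\in W(A)$ such that $w_1\Sigma\subset\Delta^{re}_+(A)$ and $w_2\Sigma\subset\Delta^{re}_-(A)$ if and only if $B$ is of finite type.
   Context: A generalized Cartan matrix (GCM) is an integer $n\times n$ matrix $A=(a_{ij})$ with $a_{ii}=2$, $a_{ij}\le 0$ for $i\ne j$, and $a_{ij}=0$ whenever $a_{ji}=0$. It is symmetrizable if $DA$ is symmetric for some diagonal matrix $D$ with positive rational diagonal entries. $\mathfrak{g}(A)$ is the associated Kac-Moody algebra over $\mathbb{C}$, with simple roots $\alpha_i(A)$ and root lattice $Q(A)$ (free abelian on the $\alpha_i(A)$). $\Delta^{re}_{+}(A)$ and $\Delta^{re}_-(A)$ are its sets of positive and negative real roots, and $W(A)$ is its Weyl group. For a real root $\beta=w\alpha_i$ ($w\in W(A)$) the coroot is $\beta^\vee=w(\alpha_i^\vee)$. A $\pi$-system in $A$ is a finite set of distinct real roots $\{\beta_1,\dots,\beta_m\}$ of $\mathfrak{g}(A)$ such that $\beta_i-\beta_j$ is not a root for all $i\neq j$. Its type is the matrix $B=(\langle\beta_i^\vee,\beta_j\rangle)_{i,j}$, which is a GCM; GCMs differing by a simultaneous permutation of rows and columns are identified. Linear independence is in $Q(A)\otimes_{\mathbb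 Z}\mathbb C$. *)

(* Defs.v *)
From HB Require Import structures.
From mathcomp Require Import all_boot all_order all_algebra perm.
From mathcomp Require Import generic_quotient boolp reals.
From mathcomp Require Import complex.

Set Implicit Arguments.
Unset Strict Implicit.
Unset Printing Implicit Defensive.

Import Order.TTheory GRing.Theory Num.Theory.
Local Open Scope ring_scope.
Local Open Scope quotient_scope.

HB.mixin Record isLieAlgebra (K : fieldType) L of GRing.Lmodule K L := {
  lie : L -> L -> L;
  lieDl : forall x y z, lie (x + y) z = lie x z + lie y z;
  lieDr : forall x y z, lie x (y + z) = lie x y + lie x z;
  lieZl : forall (a : K) x y, lie (a *: x) y = a *: lie x y;
  lieZr : forall (a : K) x y, lie x (a *: y) = a *: lie x y;
  liexx : forall x, lie x x = 0;
  jacobi : forall x y z, lie x (lie y z) + lie y (lie z x) + lie z (lie x y) = 0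
}.

#[short(type="lieAlgType")]
HB.structure Definition LieAlgebra (K : fieldType) :=
  {L of GRing.Lmodule K L & isLieAlgebra K L}.

Definition lie_ideal (K : fieldType) (L : lieAlgType K) (I : L -> Prop) : Prop :=
  [/\ I 0,
      forall x y, I x -> I y -> I (x + y),
      forall (a : K) x, I x -> I (a *: x)
    & forall x y, I y -> I (lie x y)].

Section Presentation.
Variables (K : fieldType) (X : Type).

Inductive lie_term : Type :=
| TGen of X
| TZero
| TAdd of lie_term & lie_term
| TScale of K & lie_term
| TBr of lie_term & lie_term.

Definition TSub (s t : lie_term) : lie_term := TAdd s (TScale (-1) t).

Variable rel : lie_term -> Prop.

(* Least congruence that imposes the axioms of a Lie algebra over K and t = 0
   for every relator t. *)
Inductive lie_eq : lie_term -> lie_term -> Prop :=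
| lie_eq_refl t : lie_eq t t
| lie_eq_sym s t : lie_eq s t -> lie_eq t s
| lie_eq_trans s t u : lie_eq s t -> lie_eq t u -> lie_eq s u
| lie_eq_add s s' t t' : lie_eq s s' -> lie_eq t t' -> lie_eq (TAdd s t) (TAdd s' t')
| lie_eq_scale a s s' : lie_eq s s' -> lie_eq (TScale a s) (TScale a s')
| lie_eq_br s s' t t' : lie_eq s s' -> lie_eq t t' -> lie_eq (TBr s t) (TBr s' t')
| lie_eq_addA s t u : lie_eq (TAdd s (TAdd t u)) (TAdd (TAdd s t) u)
| lie_eq_addC s t : lie_eq (TAdd s t) (TAdd t s)
| lie_eq_add0 t : lie_eq (TAdd TZero t) t
| lie_eq_addN t : lie_eq (TAdd (TScale (-1) t) t) TZero
| lie_eq_scaleA a b t : lie_eq (TScale a (TScale b t)) (TScale (a * b) t)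
| lie_eq_scale1 t : lie_eq (TScale 1 t) t
| lie_eq_scaleDr a s t : lie_eq (TScale a (TAdd s t)) (TAdd (TScale a s) (TScale a t))
| lie_eq_scaleDl a b t : lie_eq (TScale (a + b) t) (TAdd (TScale a t) (TScale b t))
| lie_eq_brDl s t u : lie_eq (TBr (TAdd s t) u) (TAdd (TBr s u) (TBr t u))
| lie_eq_brDr s t u : lie_eq (TBr s (TAdd t u)) (TAdd (TBr s t) (TBr s u))
| lie_eq_brZl a s t : lie_eq (TBr (TScale a s) t) (TScale a (TBr s t))
| lie_eq_brZr a s t : lie_eq (TBr s (TScale a t)) (TScale a (TBr s t))
| lie_eq_brxx t : lie_eq (TBr t t) TZero
| lie_eq_jacobi s t u :
    lie_eq (TAdd (TAdd (TBr s (TBr t u)) (TBr t (TBr u s))) (TBr u (TBr s t))) TZero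
| lie_eq_rel t : rel t -> lie_eq t TZero.

HB.instance Definition _ := gen_eqMixin lie_term.
HB.instance Definition _ := gen_choiceMixin lie_term.

Definition lie_eqb (s t : lie_term) : bool := `[< lie_eq s t >].

Lemma lie_eqb_equiv : equiv_class_of lie_eqb.
Proof.
split=> [t|s t|t s u].
- by apply/asboolP; exact: lie_eq_refl.
- by apply/asboolP/asboolP; exact: lie_eq_sym.
- by move=> /asboolP st /asboolP tu; apply/asboolP; apply: lie_eq_trans tu.
Qed.

Canonical lie_eqb_rel := EquivRelPack lie_eqb_equiv.

Definition presented : Type := {eq_quot lie_eqb}.
HB.instance Definition _ := EqQuotient.on presented.
HB.instance Definition _ := Choice.on presented.

Definition cls (t : lie_term) : presented := \pi_presented t.

Lemma clsP s t : cls s = cls t <-> lie_eq s t.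
Proof.
by split=> [/eqmodP/asboolP//|st]; apply/eqmodP/asboolP.
Qed.

Lemma cls_repr (x : presented) : cls (repr x) = x.
Proof. exact: reprK. Qed.

Lemma repr_cls t : lie_eq (repr (cls t)) t.
Proof. by apply/clsP; rewrite cls_repr. Qed.

Definition pres_zero : presented := cls TZero.
Definition pres_add (x y : presented) : presented := cls (TAdd (repr x) (repr y)).
Definition pres_opp (x : presented) : presented := cls (TScale (-1) (repr x)).
Definition pres_scale (a : K) (x : presented) : presented :=
  cls (TScale a (repr x)).
Definition pres_lie (x y : presented) : presented := cls (TBr (repr x) (repr y)).

Lemma cls_addE s t : pres_add (cls s) (cls t) = cls (TAdd s t).
Proof. by apply/clsP/lie_eq_add; exact: repr_cls. Qed.

Lemma cls_scaleE a t : pres_scale a (cls t) = cls (TScale a t).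
Proof. by apply/clsP/lie_eq_scale; exact: repr_cls. Qed.

Lemma cls_oppE t : pres_opp (cls t) = cls (TScale (-1) t).
Proof. exact: cls_scaleE. Qed.

Lemma cls_lieE s t : pres_lie (cls s) (cls t) = cls (TBr s t).
Proof. by apply/clsP/lie_eq_br; exact: repr_cls. Qed.

Let clsE := (cls_addE, cls_oppE, cls_scaleE, cls_lieE).

Lemma presP (P : presented -> Prop) : (forall t, P (cls t)) -> forall x, P x.
Proof. by move=> Pt x; rewrite -[x]cls_repr. Qed.

Lemma pres_addA : associative pres_add.
Proof.
by do 3![elim/presP=> ?]; rewrite !clsE; apply/clsP; exact: lie_eq_addA.
Qed.

Lemma pres_addC : commutative pres_add.
Proof. by do 2![elim/presP=> ?]; rewrite !clsE; apply/clsP; exact: lie_eq_addC. Qed.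

Lemma pres_add0 : left_id pres_zero pres_add.
Proof. by elim/presP=> ?; rewrite !clsE; apply/clsP; exact: lie_eq_add0. Qed.

Lemma pres_addN : left_inverse pres_zero pres_opp pres_add.
Proof. by elim/presP=> ?; rewrite !clsE; apply/clsP; exact: lie_eq_addN. Qed.

HB.instance Definition _ :=
  GRing.isZmodule.Build presented pres_addA pres_addC pres_add0 pres_addN.

Lemma clsD s t : cls (TAdd s t) = cls s + cls t.
Proof. by rewrite -cls_addE. Qed.

Lemma pres_scaleA a b x : pres_scale a (pres_scale b x) = pres_scale (a * b) x.
Proof. by elim/presP: x => ?; rewrite !clsE; apply/clsP; exact: lie_eq_scaleA. Qed.

Lemma pres_scale1 : left_id 1 pres_scale.
Proof. by elim/presP=> ?; rewrite !clsE; apply/clsP; exact: lie_eq_scale1. Qed.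

Lemma pres_scaleDr : right_distributive pres_scale +%R.
Proof.
move=> a; do 2![elim/presP=> ?].
by rewrite -clsD !clsE -clsD; apply/clsP; exact: lie_eq_scaleDr.
Qed.

Lemma pres_scaleDl x : {morph pres_scale^~ x : a b / a + b}.
Proof.
move=> a b; elim/presP: x => ?.
by rewrite !clsE -clsD; apply/clsP; exact: lie_eq_scaleDl.
Qed.

HB.instance Definition _ := GRing.Zmodule_isLmodule.Build K presented
  pres_scaleA pres_scale1 pres_scaleDr pres_scaleDl.

Lemma clsZ a t : cls (TScale a t) = a *: cls t.
Proof. by rewrite -cls_scaleE. Qed.

Lemma pres_lieDl x y z : pres_lie (x + y) z = pres_lie x z + pres_lie y z.
Proof.
elim/presP: x => ?; elim/presP: y => ?; elim/presP: z => ?.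
by rewrite -clsD !clsE -clsD; apply/clsP; exact: lie_eq_brDl.
Qed.

Lemma pres_lieDr x y z : pres_lie x (y + z) = pres_lie x y + pres_lie x z.
Proof.
elim/presP: x => ?; elim/presP: y => ?; elim/presP: z => ?.
by rewrite -clsD !clsE -clsD; apply/clsP; exact: lie_eq_brDr.
Qed.

Lemma pres_lieZl a x y : pres_lie (a *: x) y = a *: pres_lie x y.
Proof.
elim/presP: x => ?; elim/presP: y => ?.
by rewrite -clsZ !clsE -clsZ; apply/clsP; exact: lie_eq_brZl.
Qed.

Lemma pres_lieZr a x y : pres_lie x (a *: y) = a *: pres_lie x y.
Proof.
elim/presP: x => ?; elim/presP: y => ?.
by rewrite -clsZ !clsE -clsZ; apply/clsP; exact: lie_eq_brZr.
Qed.

Lemma pres_liexx x : pres_lie x x = 0.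
Proof. by elim/presP: x => ?; rewrite !clsE; apply/clsP; exact: lie_eq_brxx. Qed.

Lemma pres_jacobi x y z :
  pres_lie x (pres_lie y z) + pres_lie y (pres_lie z x)
    + pres_lie z (pres_lie x y) = 0.
Proof.
elim/presP: x => ?; elim/presP: y => ?; elim/presP: z => ?.
by rewrite !clsE -!clsD; apply/clsP; exact: lie_eq_jacobi.
Qed.

HB.instance Definition _ := isLieAlgebra.Build K presented
  pres_lieDl pres_lieDr pres_lieZl pres_lieZr pres_liexx pres_jacobi.

Lemma cls_lie s t : cls (TBr s t) = lie (cls s) (cls t).
Proof. by rewrite -cls_lieE. Qed.

End Presentation.

Definition gcm (n : nat) (A : 'M[int]_n) : Prop :=
  [/\ forall i, A i i = 2,
      forall i j, i != j -> A i j <= 0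
    & forall i j, A j i = 0 -> A i j = 0].

Definition symmetrizable (n : nat) (A : 'M[int]_n) : Prop :=
  exists d : 'rV[rat]_n, (forall i, 0 < d 0 i) /\
    let DA := diag_mx d *m map_mx intr A in DA^T = DA.

Definition indecomposable (n : nat) (A : 'M[int]_n) : Prop :=
  forall J : {set 'I_n},
    (forall i j, i \in J -> j \notin J -> A i j = 0 /\ A j i = 0) ->
    J = set0 \/ J = [set: 'I_n].

(* Condition (Fin) of Kac's trichotomy for indecomposable GCMs. *)
Definition finite_type (R : realType) (n : nat) (A : 'M[int]_n) : Prop :=
  let AR : 'M[R]_n := map_mx intr A in
  [/\ \det A != 0,
      exists u : 'cV[R]_n,
        (forall i, 0 < u i 0) /\ (forall i, 0 < (AR *m u) i 0)
    & forall v : 'cV[R]_n, (forall i, 0 <= (AR *m v) i 0) ->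
        (forall i, 0 < v i 0) \/ v = 0].

(* A realization of A: the Cartan subalgebra is h = 'rV_d, its dual is 'cV_d,
   the coroots are the rows of rcoroot and the simple roots the columns of
   rroot. *)
Record realization (R : realType) (n : nat) (A : 'M[int]_n) := Realization {
  rdim : nat;
  rcoroot : 'M[R[i]]_(n, rdim);
  rroot : 'M[R[i]]_(rdim, n);
  rcoroot_free : row_free rcoroot;
  rroot_free : row_free rroot^T;
  rpairing : rcoroot *m rroot = map_mx intr A;
  rdimE : (rdim + \rank (map_mx intr A : 'M[R[i]]_n) = 2 * n)%N
}.

Lemma realization_exists (R : realType) (n : nat) (A : 'M[int]_n) :
  inhabited (realization R A).
Proof.
pose AC : 'M[R[i]]_n := map_mx intr A.
pose Q : 'M[R[i]]_(_, n) := row_base (AC^C)%MS.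
have free1 : row_free (row_mx 1%:M 0 : 'M[R[i]]_(n, n + \rank (AC^C)%MS)).
  by apply/row_freeP; exists (col_mx 1%:M 0); rewrite mul_row_col mulmx1 mul0mx addr0.
have free2 : row_free ((col_mx AC Q)^T).
  rewrite -row_leq_rank mxrank_tr -{1}(mxrank1 R[i] n) mxrankS // -addsmxE.
  apply: submx_trans (_ : (1%:M <= AC + AC^C)%MS) _.
    by rewrite submx_full // addsmx_compl_full.
  by rewrite addsmxS // eq_row_base.
have pairing : row_mx 1%:M 0 *m col_mx AC Q = map_mx intr A.
  by rewrite mul_row_col mul1mx mul0mx addr0.
apply: inhabits; apply: (Realization free1 free2 pairing).
by rewrite -/AC mxrank_compl -addnA subnK ?rank_leq_row // addnn mul2n.
Qed.

Section KacMoody.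
Variables (R : realType) (n : nat) (A : 'M[int]_n) (r : realization R A).
Local Notation C := R[i].
Local Notation d := (rdim r).

Inductive chevalley_gen : Type :=
| GenH of 'rV[C]_d
| GenE of 'I_n
| GenF of 'I_n.

Local Notation H h := (TGen C (GenH h)).
Local Notation E i := (TGen C (GenE i)).
Local Notation F i := (TGen C (GenF i)).

Inductive chevalley_rel : lie_term C chevalley_gen -> Prop :=
| RelLin a h h' :
    chevalley_rel (TSub (H (a *: h + h')) (TAdd (TScale a (H h)) (H h')))
| RelHH h h' : chevalley_rel (TBr (H h) (H h'))
| RelEF i j :
    chevalley_rel (TSub (TBr (E i) (F j)) (H ((i == j)%:R *: row i (rcoroot r))))
| RelHE h i :
    chevalley_rel (TSub (TBr (H h) (E i)) (TScale ((h *m rroot r) 0 i) (E i)))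
| RelHF h i :
    chevalley_rel (TSub (TBr (H h) (F i)) (TScale (- (h *m rroot r) 0 i) (F i))).

(* The algebra that Kac denotes by g(A) with a tilde. *)
Definition kac_moody_tilde : lieAlgType C := presented chevalley_rel.

(* g(A) is the quotient of kac_moody_tilde by the sum of its ideals that meet
   the Cartan subalgebra trivially; the elements of these ideals are the
   additional relators. *)
Inductive kac_moody_rel : lie_term C chevalley_gen -> Prop :=
| RelTilde t : chevalley_rel t -> kac_moody_rel t
| RelRadical (I : kac_moody_tilde -> Prop) t :
    lie_ideal I ->
    (forall h, I (cls chevalley_rel (H h)) -> cls chevalley_rel (H h) = 0) ->
    I (cls chevalley_rel t) -> kac_moody_rel t.

Definition kac_moody : lieAlgType C := presented kac_moody_rel.

Definition cartan (h : 'rV[C]_d) : kac_moody := cls kac_moody_rel (H h).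

(* The value at h of the element \sum_j a_j alpha_j of the root lattice. *)
Definition root_eval (a : 'rV[int]_n) (h : 'rV[C]_d) : C :=
  \sum_j (a 0 j)%:~R * (h *m rroot r) 0 j.

Definition is_root (a : 'rV[int]_n) : Prop :=
  a != 0 /\
  exists x : kac_moody, x != 0 /\ forall h, lie (cartan h) x = root_eval a h *: x.

End KacMoody.

(* The root lattice Q(A) and the coroot lattice are both 'rV[int]_n, in
   coordinates with respect to the simple roots, resp. the simple coroots. *)

Section Weyl.
Variables (n : nat) (A : 'M[int]_n).

Definition simple_root (i : 'I_n) : 'rV[int]_n := delta_mx 0 i.

(* <c, a> for c in the coroot lattice and a in the root lattice. *)
Definition cartan_pairing (c a : 'rV[int]_n) : int := (c *m A *m a^T) 0 0.

Definition srefl (i : 'I_n) (a : 'rV[int]_n) : 'rV[int]_n :=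
  a - cartan_pairing (simple_root i) a *: simple_root i.

Definition scorefl (i : 'I_n) (c : 'rV[int]_n) : 'rV[int]_n :=
  c - cartan_pairing c (simple_root i) *: simple_root i.

(* An element of W(A) is represented by a word [:: i1; ...; ik] that stands for
   the product of simple reflections s_i1 ... s_ik, so that quantifying over
   words is quantifying over W(A). *)
Definition weyl_act (w : seq 'I_n) (a : 'rV[int]_n) : 'rV[int]_n :=
  foldr srefl a w.

Definition weyl_coact (w : seq 'I_n) (c : 'rV[int]_n) : 'rV[int]_n :=
  foldr scorefl c w.

Definition real_root (a : 'rV[int]_n) : Prop :=
  exists w i, a = weyl_act w (simple_root i).

Definition real_root_pos (a : 'rV[int]_n) : Prop :=
  real_root a /\ forall j, 0 <= a 0 j.

Definition real_root_neg (a : 'rV[int]_n) : Prop :=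
  real_root a /\ forall j, a 0 j <= 0.

Definition is_coroot (a c : 'rV[int]_n) : Prop :=
  exists w i, a = weyl_act w (simple_root i) /\ c = weyl_coact w (simple_root i).

End Weyl.

Definition pi_system (R : realType) (n : nat) (A : 'M[int]_n)
    (r : realization R A) (m : nat) (beta : 'I_m -> 'rV[int]_n) : Prop :=
  [/\ injective beta,
      forall i, real_root A (beta i)
    & forall i j, i != j -> ~ is_root r (beta i - beta j)].

(* The permutation s reflects that types are taken up to simultaneous
   permutations of rows and columns. *)
Definition has_type (n : nat) (A : 'M[int]_n) (m : nat)
    (beta : 'I_m -> 'rV[int]_n) (B : 'M[int]_m) : Prop :=
  exists (s : 'S_m) (beta_check : 'I_m -> 'rV[int]_n),
    (forall i, is_coroot A (beta i) (beta_check i)) /\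
    forall i j, B (s i) (s j) = cartan_pairing A (beta_check i) (beta j).

Definition lin_indep (R : realType) (n m : nat)
    (beta : 'I_m -> 'rV[int]_n) : Prop :=
  row_free (\matrix_(i < m, j < n) ((beta i 0 j)%:~R : R[i])).

(* Main.v *)
(** The pi-system embeds the root lattice of B into that of A so that every
reflection of W(B) is induced by an element of W(A); real roots of B become real
roots of A, hence are positive or negative there.  Each element of W(A) changes
the sign of only finitely many real roots, so if only finitely many positive
roots of B become negative in A, they can be made positive one by one by
reflecting in simple roots of B.  Thus (1) amounts to: the positive roots of B
cannot split into two infinite families D (negative in A) and E (positive in A).

Suppose they do.  For a in D and almost all g in E the reflection s_a g is again
positive for B and positive in A, which bounds |(a|g)| height(a) / height(g)
independently of a and g.  Applying this to both a and s_i a and letting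
height(a) tend to infinity shows <alpha_i^vee, g> = o(height(g)) on E.  By
compactness there is v >= 0 of height 1 with B v = 0 whose image in A is >= 0.
Exchanging D and E yields such a v with image <= 0.  As B is indecomposable, both
vectors coincide, so v has image 0, against linear independence.

If B is of finite type, the invariant form is positive definite, so B has only
finitely many roots and both signs are possible.  Conversely, if both signs are
possible, all positive roots of B are inverted by one element of W(A), so there
are finitely many of them; their sum u satisfies u > 0 and B u > 0. *)

Require Import Defs.
From mathcomp Require Import all_boot all_order all_algebra perm complex.
From mathcomp Require Import boolp functions classical_sets reals topology.
From mathcomp Require Import normedtype derive zify ring.

Set Implicit Arguments.
Unset Strict Implicit.
Unset Printing Implicit Defensive.

Import Order.TTheory GRing.Theory Num.Theory.
Local Open Scope ring_scope.

(** * The Weyl group action and the signs of real roots *)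

Definition nneg n (x : 'rV[int]_n) := forall j, 0 <= x 0 j.

Section WeylAction.
Variables (n : nat) (A : 'M[int]_n).
Implicit Types (x y : 'rV[int]_n) (w : seq 'I_n).
Local Notation act := (weyl_act A).
Local Notation e := (@simple_root n).

Lemma cartan_pairingDr c x y :
  cartan_pairing A c (x + y) = cartan_pairing A c x + cartan_pairing A c y.
Proof. by rewrite /cartan_pairing raddfD /= mulmxDr mxE. Qed.

Lemma cartan_pairingZr c (k : int) x :
  cartan_pairing A c (k *: x) = k * cartan_pairing A c x.
Proof. by rewrite /cartan_pairing linearZ /= -scalemxAr mxE. Qed.

Lemma cartan_pairingDl c d x :
  cartan_pairing A (c + d) x = cartan_pairing A c x + cartan_pairing A d x.
Proof. by rewrite /cartan_pairing !mulmxDl mxE. Qed.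

Lemma cartan_pairingZl (k : int) c x :
  cartan_pairing A (k *: c) x = k * cartan_pairing A c x.
Proof. by rewrite /cartan_pairing -!scalemxAl mxE. Qed.

Lemma cartan_pairing_row i x : cartan_pairing A (e i) x = \sum_j A i j * x 0 j.
Proof.
rewrite /cartan_pairing /simple_root -rowE mxE.
by apply: eq_bigr => j _; rewrite !mxE.
Qed.

Lemma cartan_pairing_simple i j : cartan_pairing A (e i) (e j) = A i j.
Proof.
rewrite cartan_pairing_row (bigD1 j) //= big1 => [|k /negPf kj].
  by rewrite mxE !eqxx mulr1 addr0.
by rewrite mxE kj andbF mulr0.
Qed.

Lemma sreflE i x j :
  srefl A i x 0 j = x 0 j - cartan_pairing A (e i) x * (j == i)%:R.
Proof. by rewrite /srefl !mxE eqxx. Qed.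

Lemma sreflD i x y : srefl A i (x + y) = srefl A i x + srefl A i y.
Proof. by rewrite /srefl cartan_pairingDr scalerDl opprD addrACA. Qed.

Lemma sreflZ i (k : int) x : srefl A i (k *: x) = k *: srefl A i x.
Proof. by rewrite /srefl cartan_pairingZr -scalerA scalerBr. Qed.

Lemma actD w x y : act w (x + y) = act w x + act w y.
Proof. by elim: w => //= i w ->; rewrite sreflD. Qed.

Lemma actZ w (k : int) x : act w (k *: x) = k *: act w x.
Proof. by elim: w => //= i w ->; rewrite sreflZ. Qed.

Lemma actN w x : act w (- x) = - act w x.
Proof. by rewrite -!scaleN1r actZ. Qed.

Lemma act_cat w1 w2 x : act (w1 ++ w2) x = act w1 (act w2 x).
Proof. by rewrite /weyl_act foldr_cat. Qed.

Lemma act_rcons w i x : act (rcons w i) x = act w (srefl A i x).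
Proof. by rewrite -cats1 act_cat. Qed.

Hypothesis gcmA : gcm A.

Lemma gcm_diag i : A i i = 2.
Proof. by case: gcmA. Qed.

Lemma srefl_simple i : srefl A i (e i) = - e i.
Proof.
by rewrite /srefl cartan_pairing_simple gcm_diag scaler_nat mulr2n opprD addNKr.
Qed.

Lemma sreflK i : involutive (srefl A i).
Proof.
move=> x; rewrite {2}/srefl sreflD -scaleN1r !sreflZ srefl_simple scalerN.
by rewrite !scaleN1r opprK /srefl subrK.
Qed.

Lemma act_revK w : cancel (act w) (act (rev w)).
Proof.
elim: w => //= i w IH x; rewrite rev_cons act_rcons sreflK; exact: IH.
Qed.

Lemma act_rev_inv w : cancel (act (rev w)) (act w).
Proof. by move=> x; rewrite -{1}(revK w) act_revK. Qed.

Lemma act_inj w : injective (act w).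
Proof. exact: can_inj (act_revK w). Qed.

Lemma act_real_root w x : real_root A x -> real_root A (act w x).
Proof. by case=> w' [i ->]; exists (w ++ w'), i; rewrite act_cat. Qed.

Lemma simple_real_root i : real_root A (e i).
Proof. by exists [::], i. Qed.

Lemma real_rootN x : real_root A x -> real_root A (- x).
Proof.
by case=> w [i ->]; exists (rcons w i), i; rewrite act_rcons srefl_simple actN.
Qed.

Lemma real_root_neq0 x : real_root A x -> x != 0.
Proof.
case=> w [i ->]; apply/eqP => w0.
have := act_revK w (e i); rewrite w0 -{1}(scale0r (0 : 'rV[int]_n)) actZ scale0r.
by move=> /rowP/(_ i); rewrite !mxE !eqxx.
Qed.

(** * Reduced words and dihedral subgroups *)

Definition same_act w w' := forall x, act w x = act w' x.

(** An element of W(A) is a word up to [same_act], so this is minimality of length in W(A). *)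
Definition reduced w := forall w', same_act w w' -> (size w <= size w')%N.

Lemma reduced_exists w :
  exists w', [/\ reduced w', same_act w w' & (size w' <= size w)%N].
Proof.
have [k] := ubnP (size w); elim: k w => // k IH w.
rewrite ltnS => wk.
have [rw|] := pselect (reduced w); first by exists w.
move=> /existsNP [w' /not_implyP [ww' /negP]]; rewrite -ltnNge => lt.
have [w'' [r s le]] := IH w' (leq_trans lt wk).
by exists w''; split=> // [x|]; [rewrite ww' | apply: leq_trans le (ltnW lt)].
Qed.

(** The alternating word of length k in i and j that ends in j. *)
Fixpoint altw k (i j : 'I_n) : seq 'I_n :=
  if k is k'.+1 then rcons (altw k' j i) j else [::].

Lemma size_altw k i j : size (altw k i j) = k.
Proof. by elim: k i j => //= k IH i j; rewrite size_rcons IH. Qed.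

Lemma altw_cat k l i j :
  altw (k + l) i j = (if odd l then altw k j i else altw k i j) ++ altw l i j.
Proof.
elim: l i j => [|l IH] i j; first by rewrite addn0 cats0.
by rewrite addnS /= IH -!cats1 catA if_neg.
Qed.

Section Dihedral.
Variables (i j : 'I_n).
Let a : int := - A i j.
Let b : int := - A j i.

Lemma srefl_comb1 x (p q : int) :
  srefl A i (x + (p *: e i + q *: e j)) =
  x + ((a * q - p - cartan_pairing A (e i) x) *: e i + q *: e j).
Proof.
rewrite /srefl !cartan_pairingDr !cartan_pairingZr !cartan_pairing_simple.
by rewrite gcm_diag; apply/rowP => l; rewrite !mxE /a; ring.
Qed.

Lemma srefl_comb2 x (p q : int) :
  srefl A j (x + (p *: e i + q *: e j)) =
  x + (p *: e i + (b * p - q - cartan_pairing A (e j) x) *: e j).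
Proof.
rewrite /srefl !cartan_pairingDr !cartan_pairingZr !cartan_pairing_simple.
by rewrite gcm_diag; apply/rowP => l; rewrite !mxE /b; ring.
Qed.

Lemma srefl_pos1 (p q : int) :
  srefl A i (p *: e i + q *: e j) = (a * q - p) *: e i + q *: e j.
Proof.
have := srefl_comb1 0 p q; rewrite !add0r => ->.
by rewrite /cartan_pairing trmx0 mulmx0 mxE subr0.
Qed.

Lemma srefl_pos2 (p q : int) :
  srefl A j (p *: e i + q *: e j) = p *: e i + (b * p - q) *: e j.
Proof.
have := srefl_comb2 0 p q; rewrite !add0r => ->.
by rewrite /cartan_pairing trmx0 mulmx0 mxE subr0.
Qed.

Definition finite_dihedral m := same_act (altw m i j) (altw m j i) /\
  forall k, (k < m)%N -> exists p q : int,
    [/\ 0 <= p, 0 <= q & act (altw k i j) (e i) = p *: e i + q *: e j].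

(* The triples are (order of s_i s_j, -a_ij, -a_ji). *)
Lemma finite_dihedralP (m : nat) (a0 b0 : int) : a = a0 -> b = b0 ->
  (m, a0, b0) \in [:: (2%N, 0, 0); (3%N, 1, 1); (4%N, 1, 2); (4%N, 2, 1);
                    (6%N, 1, 3); (6%N, 3, 1)] ->
  finite_dihedral m.
Proof.
have e0 x : x = x + (0 *: e i + 0 *: e j) by rewrite !scale0r !addr0.
have e1 : e i = 1 *: e i + 0 *: e j by rewrite scale0r addr0 scale1r.
have combE (y z u : 'rV[int]_n) (p q p' q' : int) : p = p' -> q = q' ->
    y + (p *: z + q *: u) = y + (p' *: z + q' *: u) by move=> -> ->.
move=> aE bE; rewrite !inE => mab; split=> [x|k].
{ rewrite [in LHS](e0 x) [in RHS](e0 x).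
  move: mab; do ![case/orP]; case/eqP=> -> a1 b1; rewrite ?a1 ?b1 in aE bE;
    rewrite /= ?(srefl_comb1, srefl_comb2) aE bE;
    set f := cartan_pairing _ _ x; set g := cartan_pairing _ _ x; clearbody f g.
  all: refine (combE _ _ _ _ _ _ _ _ _).
  all: lia.
}
rewrite (congr1 (act _) e1).
move: mab; do ![case/orP]; case/eqP=> -> a1 b1; rewrite ?a1 ?b1 in aE bE;
  do 7?[case: k => [_|k //]]; rewrite /= ?(srefl_pos1, srefl_pos2) ?aE ?bE.
all: (do 2!eexists; split; [ | |reflexivity]).
all: done.
Qed.

End Dihedral.

Lemma same_act_sym w w' : same_act w w' -> same_act w' w.
Proof. by move=> h x; rewrite h. Qed.

Lemma same_act_rcons2 w i : same_act (rcons (rcons w i) i) w.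
Proof. by move=> x; rewrite !act_rcons sreflK. Qed.

Lemma gcm_offdiag i j : i != j -> A i j <= 0.
Proof. by case: gcmA => _ + _; apply. Qed.

Lemma gcm_eq0 i j : A j i = 0 -> A i j = 0.
Proof. by case: gcmA => _ _; apply. Qed.

(* The bound on q survives each step because a_ij a_ji >= 4. *)
Lemma altw_infinite k i j (p q : int) :
  i != j -> 4 <= A i j * A j i -> 0 <= p -> 0 <= q -> - A i j * q <= 2 * p ->
  exists p' q' : int, [/\ 0 <= p', 0 <= q' &
    act (altw k i j) (p *: e i + q *: e j) = p' *: e i + q' *: e j].
Proof.
elim: k i j p q => [|k IH] i j p q ij ab p0 q0 pq; first by exists p, q.
have a0 := gcm_offdiag ij; have ji : j != i by rewrite eq_sym.
have b0 := gcm_offdiag ji.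
rewrite /= act_rcons srefl_pos2 //.
have bq : 2 * q <= - A j i * p by nia.
have [||||p' [q' [p'0 q'0 E]]] := IH j i (- A j i * p - q) p ji; [lia|lia|lia|lia|].
by exists q', p'; split=> //; rewrite addrC E addrC.
Qed.

(** If a_ij a_ji >= 4, [altw_infinite] applies to every k. Otherwise s_i s_j has finite order m, and
    k >= m is impossible: the braid relation would shorten the product of the alternating word with
    s_i. *)
Lemma altw_simple_nneg i j k : i != j ->
  (forall x : seq 'I_n, all (mem [:: i; j]) x -> same_act x (rcons (altw k i j) i) ->
     (k <= size x)%N) ->
  exists p q : int,
    [/\ 0 <= p, 0 <= q & act (altw k i j) (e i) = p *: e i + q *: e j].
Proof.
move=> ij short; have ji : j != i by rewrite eq_sym.
have := gcm_offdiag ij; have := gcm_offdiag ji.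
have := @gcm_eq0 i j; have := @gcm_eq0 j i.
have [ab4|ab3] := boolP (4 <= A i j * A j i) => za zb a0 b0.
  have [|||||p [q pq]] // := @altw_infinite k i j 1 0; first by rewrite mulr0.
  by exists p, q; move: pq; rewrite scale0r addr0 scale1r.
have [m [m0 [braid simp]]] : exists m, (0 < m)%N /\ finite_dihedral i j m.
  have abs : (- A i j, - A j i) \in
     [:: (0, 0); (1, 1); (1, 2); (2, 1); (1, 3); (3, 1)].
    rewrite !inE !xpair_eqE.
    have [b_0|b_0] := eqVneq (A j i) 0; first by rewrite (zb b_0) b_0.
    have a_0 : A i j != 0 by apply: contra_neq b_0 => /za.
    nia.
  have mk m (p q : int) : (0 < m)%N -> - A i j = p -> - A j i = q ->
    (m, p, q) \in [:: (2%N, 0, 0); (3%N, 1, 1); (4%N, 1, 2); (4%N, 2, 1);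
                    (6%N, 1, 3); (6%N, 3, 1)] ->
    exists m, (0 < m)%N /\ finite_dihedral i j m.
    by move=> m0 ap bq mpq; exists m; split=> //; apply: finite_dihedralP mpq.
  move: abs; rewrite !inE.
  case/orP=> [/eqP[ap bq]|]; first exact: (mk 2%N _ _ _ ap bq).
  case/orP=> [/eqP[ap bq]|]; first exact: (mk 3%N _ _ _ ap bq).
  case/orP=> [/eqP[ap bq]|]; first exact: (mk 4%N _ _ _ ap bq).
  case/orP=> [/eqP[ap bq]|]; first exact: (mk 4%N _ _ _ ap bq).
  case/orP=> [/eqP[ap bq]|]; first exact: (mk 6%N _ _ _ ap bq).
  by move=> /eqP[ap bq]; exact: (mk 6%N _ _ _ ap bq).
have [km|mk] := ltnP k m; first exact: simp.
case: m m0 mk braid {simp} => // m _ mk braid.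
pose y := if odd m.+1 then altw (k - m.+1) j i else altw (k - m.+1) i j.
have kE : altw k i j = y ++ altw m.+1 i j by rewrite -altw_cat subnK.
have alt_ij l : all (mem [:: i; j]) (altw l i j) /\ all (mem [:: i; j]) (altw l j i).
  elim: l => //= l [IH1 IH2].
  by rewrite !all_rcons IH1 IH2 /= !inE !eqxx orbT.
(* By the braid relation, [altw m.+1 i j] followed by i equals [altw m.+1 j i] followed by i; its
   last two letters cancel and leave [altw m i j]. *)
have := short (y ++ altw m i j).
rewrite all_cat (alt_ij m).1 size_cat size_altw.
have -> : size y = (k - m.+1)%N by rewrite /y; case: ifP; rewrite size_altw.
have -> : all (mem [:: i; j]) y by rewrite /y; case: ifP; case: (alt_ij (k - m.+1)%N).
move=> /(_ isT) H; suff : (k <= k - m.+1 + m)%N by lia.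
apply: H => x; rewrite kE rcons_cat !act_cat; congr (act y _).
by rewrite -cats1 act_cat braid /= !act_rcons /= sreflK.
Qed.

(** Two equal neighbouring letters cancel, so in a word of minimal length i and j must alternate. *)
Lemma minimal_altw i j (x0 : seq 'I_n) : i != j ->
  let x := rcons x0 j in
  all (mem [:: i; j]) x ->
  (forall x' : seq 'I_n, all (mem [:: i; j]) x' -> same_act x' x ->
     (size x <= size x')%N) ->
  x = altw (size x) i j.
Proof.
elim/last_ind: x0 i j => [|x0 k IH] i j ij //=.
rewrite !all_rcons => /and3P [jin kin allx0] min.
have kj : k != j.
  apply/eqP => kj; have := min x0 allx0; rewrite kj !size_rcons => H.
  by have := H (same_act_sym (@same_act_rcons2 x0 j)); lia.
have ki : k = i by move: kin; rewrite !inE (negPf kj) orbF => /eqP.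
subst k; rewrite size_rcons /=; congr (rcons _ j).
have flip : {subset [:: i; j] <= [:: j; i]} by move=> z; rewrite !inE orbC.
have flip' : {subset [:: j; i] <= [:: i; j]} by move=> z; rewrite !inE orbC.
apply: IH => [||x' ax' same]; first by rewrite eq_sym.
  by rewrite all_rcons (sub_all flip allx0) andbT; apply: flip; rewrite inE eqxx.
have := min (rcons x' j); rewrite !size_rcons ltnS; apply.
  by rewrite all_rcons jin (sub_all flip' ax').
by move=> z; rewrite !act_rcons same !act_rcons.
Qed.

(* Tits: write w = v x with x in the dihedral group of i and j, the last letter of
   w, and v of minimal length; v maps both simple roots to nonnegative vectors by
   induction, and x maps alpha_i into their cone. *)
Lemma reduced_simple_nneg w i : reduced w ->
  (forall w', same_act w' (rcons w i) -> (size w <= size w')%N) ->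
  nneg (act w (e i)).
Proof.
have [N] := ubnP (size w); elim: N w i => // N IH w i.
rewrite ltnS => wN red short.
case: (lastP w) wN red short => {w} [_ _ _ l|w0 j wN red short].
  by rewrite mxE; case: (_ && _).
have ij : i != j.
  apply/eqP => ij; have := short w0; rewrite ij size_rcons ltnn => H.
  by have := H (same_act_sym (@same_act_rcons2 w0 j)).
set w := rcons w0 j in wN red short *.
pose dec k := exists v x : seq 'I_n, [/\ size v = k, all (mem [:: i; j]) x,
  (size v + size x = size w)%N & same_act (v ++ x) w].
have decw0 : dec (size w0).
  exists w0, [:: j]; rewrite /= !inE eqxx orbT /w size_rcons addn1; split=> //.
  by rewrite cats1.
have wS : size w = (size w0).+1 by rewrite size_rcons.
clearbody w.
have [k /asboolP [v [x [vk allx vx vxw]]] kmin] :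
    exists2 k, `[< dec k >] & forall k', `[< dec k' >] -> (k <= k')%N.
  have ex : exists k, `[< dec k >] by exists (size w0); apply/asboolP.
  by case: (ex_minnP ex) => k; exists k.
have vw : (size v < size w)%N.
  have := kmin _ (introT (asboolP _) decw0); rewrite vk wS; lia.
have redv : reduced v.
  move=> v' vv'; have := red (v' ++ x); rewrite size_cat -vx leq_add2r; apply.
  by move=> z; rewrite -vxw !act_cat vv'.
(* A word for v s_l shorter than v would allow s_l to pass into the dihedral factor, against the
   minimal length of v. *)
have shortv l : l \in [:: i; j] ->
    forall v', same_act v' (rcons v l) -> (size v <= size v')%N.
  move=> lij v' vv'; rewrite leqNgt; apply/negP => lt.
  have s : same_act (v' ++ l :: x) w.
    by move=> z; rewrite act_cat vv' act_rcons /= sreflK -act_cat.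
  have := red _ (same_act_sym s); rewrite size_cat /= -vx => le.
  suff : (k <= size v')%N by lia.
  apply: kmin; apply/asboolP; exists v', (l :: x).
  by split=> //=; [rewrite lij | lia].
have vi : nneg (act v (e i)).
  by apply: IH (shortv i _) => //; [lia | rewrite !inE eqxx].
have vj : nneg (act v (e j)).
  by apply: IH (shortv j _) => //; [lia | rewrite !inE eqxx orbT].
have xshort (x' : seq 'I_n) : all (mem [:: i; j]) x' -> same_act x' (rcons x i) ->
    (size x <= size x')%N.
  move=> _ xx'; have := short (v ++ x'); rewrite size_cat -vx leq_add2l; apply.
  by move=> z; rewrite act_cat xx' !act_rcons -act_cat vxw.
have xmin (x' : seq 'I_n) : all (mem [:: i; j]) x' -> same_act x' x ->
    (size x <= size x')%N.
  move=> _ xx'; have := red (v ++ x'); rewrite size_cat -vx leq_add2l; apply.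
  by move=> z; rewrite act_cat xx' -act_cat vxw.
(* x cannot end in i, since x s_i is not shorter than x; hence it ends in j and alternates. *)
have xE : x = altw (size x) i j.
  case: (lastP x) vx allx vxw xshort xmin => [|x0 l].
    by rewrite addn0 => vx; move: vw; rewrite -vx ltnn.
  rewrite all_rcons => vx /andP[lij allx0] vxw xshort xmin.
  have li : l != i.
    apply/eqP => li; have := xshort x0 allx0; rewrite li size_rcons ltnn => H.
    by have := H (same_act_sym (@same_act_rcons2 x0 i)).
  have lj : l = j by move: lij; rewrite !inE (negPf li) => /eqP.
  by subst l; apply: minimal_altw => //; rewrite all_rcons lij.
have [p [q [p0 q0 E]]] : exists p q : int,
    [/\ 0 <= p, 0 <= q & act x (e i) = p *: e i + q *: e j].
  by rewrite xE; apply: altw_simple_nneg; rewrite -?xE.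
move=> l; rewrite -vxw act_cat E actD !actZ mxE [X in X + _]mxE [X in _ + X]mxE.
by apply: addr_ge0; apply: mulr_ge0.
Qed.

(** The sign is decided by whether w s_i is shorter than w. If it is, then -w alpha_i = (w s_i)
    alpha_i, and multiplying w s_i by s_i on the right does not shorten it. *)
Lemma real_root_sign x : real_root A x -> nneg x \/ nneg (- x).
Proof.
case=> w0 [i ->].
have [w [red s _]] := reduced_exists w0; rewrite s.
have [short|] := pselect (forall w', same_act w' (rcons w i) -> (size w <= size w')%N).
  by left; apply: reduced_simple_nneg.
move=> /existsNP [w' /not_implyP [sw' /negP]]; rewrite -ltnNge => lt; right.
have [w1 [red1 s1 le1]] := reduced_exists w'.
have -> : - act w (e i) = act w1 (e i).
  by rewrite -actN -srefl_simple -act_rcons -sw' s1.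
apply: reduced_simple_nneg => // w2 sw2; apply: leq_trans (le1) _.
apply: leq_trans (ltnW lt) _; apply: red => z.
by rewrite sw2 act_rcons -s1 sw' act_rcons sreflK.
Qed.

End WeylAction.

(** * Inversions *)

(** The covering list may contain further elements. *)
Definition finitely_many (T : eqType) (P : T -> Prop) :=
  exists L : seq T, forall x, P x -> x \in L.

Section FinitelyMany.
Variable T : eqType.
Implicit Types P Q : T -> Prop.

Lemma finitely_many_sub P Q :
  (forall x, P x -> Q x) -> finitely_many Q -> finitely_many P.
Proof. by move=> PQ [L QL]; exists L => x /PQ /QL. Qed.

Lemma finitely_many_or P Q :
  finitely_many P -> finitely_many Q -> finitely_many (fun x => P x \/ Q x).
Proof.
move=> [L PL] [L' QL']; exists (L ++ L') => x.
by rewrite mem_cat; case=> [/PL -> | /QL' ->]; rewrite ?orbT.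
Qed.

Lemma finitely_many_all (I : finType) (P : I -> T -> Prop) :
  (forall i, finitely_many (P i)) -> finitely_many (fun x => exists i, P i x).
Proof.
move=> /choice [L PL]; exists (flatten [seq L i | i : I]) => x [i /PL xL].
by apply/flatten_mapP; exists i; rewrite ?mem_enum.
Qed.

Lemma infinitely_many_ex P Q :
  ~ finitely_many P -> finitely_many Q -> exists2 x, P x & ~ Q x.
Proof.
move=> infP finQ; apply: contrapT => noex; apply: infP.
apply: finitely_many_sub finQ => x Px; apply: contrapT => nQx.
by apply: noex; exists x.
Qed.

End FinitelyMany.

Lemma finitely_many_box n (N : nat) :
  finitely_many (fun x : 'rV[int]_n => forall j, `|x 0 j| <= N%:Z).
Proof.
exists [seq \row_j ((f j : nat)%:Z - N%:Z) | f : {ffun 'I_n -> 'I_(N + N).+1}].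
move=> x xN; apply/mapP.
exists [ffun j => inord `|(x 0 j + N%:Z)%R|%N]; first by rewrite mem_enum.
apply/rowP => j; rewrite mxE ffunE; have := xN j; move: (x 0 j) => z zN.
rewrite inordK; last by lia.
by lia.
Qed.

Definition height n (x : 'rV[int]_n) : int := \sum_j x 0 j.

Section Height.
Variable n : nat.
Implicit Types x y : 'rV[int]_n.

Lemma heightD x y : height (x + y) = height x + height y.
Proof. by rewrite /height -big_split; apply: eq_bigr => j _; rewrite mxE. Qed.

Lemma heightZ (k : int) x : height (k *: x) = k * height x.
Proof. by rewrite /height mulr_sumr; apply: eq_bigr => j _; rewrite mxE. Qed.

Lemma heightN x : height (- x) = - height x.
Proof. by rewrite -scaleN1r heightZ mulN1r. Qed.

Lemma nneg_height_ge x j : nneg x -> x 0 j <= height x.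
Proof.
move=> x0; rewrite /height (bigD1 j) //= lerDl.
by apply: sumr_ge0 => k _; apply: x0.
Qed.

Lemma nneg_height_ge0 x : nneg x -> 0 <= height x.
Proof. by move=> x0; apply: sumr_ge0 => j _; apply: x0. Qed.

Lemma nneg_height_gt0 x : nneg x -> x != 0 -> 0 < height x.
Proof.
move=> x0; apply: contra_neqT; rewrite -leNgt => h; apply/rowP => j.
by rewrite mxE; apply/eqP; rewrite eq_le (le_trans (nneg_height_ge j x0) h) x0.
Qed.

Lemma finitely_many_height (N : nat) :
  finitely_many (fun x => nneg x /\ height x <= N%:Z).
Proof.
apply: finitely_many_sub (finitely_many_box n N) => x [x0 xN] j.
by have := nneg_height_ge j x0; have := x0 j; lia.
Qed.

Lemma nneg_anti x : nneg x -> nneg (- x) -> x = 0.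
Proof.
move=> p q; apply/rowP => j; have := q j; rewrite !mxE oppr_ge0 => qj.
by apply/eqP; rewrite eq_le qj p.
Qed.

End Height.

(** * Positive real roots and inversion sets *)

Section PositiveRoots.
Variables (n : nat) (A : 'M[int]_n).
Hypothesis gcmA : gcm A.
Implicit Types x y : 'rV[int]_n.
Local Notation act := (weyl_act A).
Local Notation e := (@simple_root n).

Definition pos_root x := real_root A x /\ nneg x.

Lemma pos_root_neq0 x : pos_root x -> x != 0.
Proof. by case=> /(real_root_neq0 gcmA). Qed.

Lemma pos_root_height x : pos_root x -> 0 < height x.
Proof. by move=> px; apply: nneg_height_gt0 px.2 _; apply: pos_root_neq0. Qed.

Lemma simple_pos_root i : pos_root (e i).
Proof.
by split; [apply: simple_real_root | move=> j; rewrite mxE; case: (_ && _)].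
Qed.

(** Moving c alpha_i back to the simple root it comes from shows that c divides 1. *)
Lemma real_root_multiple (c : int) i : real_root A (c *: e i) -> c = 1 \/ c = -1.
Proof.
case=> w [j /(congr1 (act (rev w)))]; rewrite (act_revK gcmA) (actZ) => /rowP/(_ j).
rewrite !mxE !eqxx /= => cu.
have /eqP := congr1 absz cu; rewrite abszM muln_eq1 => /andP[/eqP c1 _].
by lia.
Qed.

(** s_i alters only coordinate i. If the image were negative, all other coordinates of x would
    vanish and x would be a multiple of alpha_i, hence alpha_i itself. *)
Lemma srefl_pos_root i x : pos_root x -> x != e i -> pos_root (srefl A i x).
Proof.
move=> [rx x0] xi.
have rs : real_root A (srefl A i x) by apply: (act_real_root [:: i]).
split=> //; have [//|ns] := real_root_sign gcmA rs.
have xE : x = x 0 i *: e i.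
  apply/rowP => j; have := ns j; rewrite mxE sreflE !mxE eqxx /= oppr_ge0.
  have [->|ji] := eqVneq j i; rewrite ?mulr1 // !mulr0 subr0 => xj.
  by apply/eqP; rewrite eq_le xj x0.
have := rx; rewrite xE => /real_root_multiple; have := x0 i.
have : x 0 i != 1 by apply: contra xi => /eqP x1; rewrite xE x1 scale1r.
by lia.
Qed.

(** s_i inverts only alpha_i, so passing from w to s_i w adds at most the root w^-1 alpha_i. *)
Lemma finitely_many_inversions w :
  finitely_many (fun x => pos_root x /\ nneg (- act w x)).
Proof.
elim: w => [|i w [L IH]].
  exists [::] => x [px nx]; have := pos_root_neq0 px.
  by rewrite (nneg_anti px.2 nx) eqxx.
exists (act (rev w) (e i) :: L) => x [px nx]; rewrite inE.
have rx : real_root A (act w x) by apply: act_real_root; case: px.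
have [wx|wx] := real_root_sign gcmA rx; last by rewrite IH ?orbT.
have [<-|wxi] := eqVneq (act w x) (e i); first by rewrite (act_revK gcmA) eqxx.
have ps := srefl_pos_root (conj rx wx) wxi.
by have := pos_root_neq0 ps; rewrite (nneg_anti ps.2 nx) eqxx.
Qed.

End PositiveRoots.

(** * Finite type *)

Section FiniteType.
Variables (n : nat) (A : 'M[int]_n).
Hypothesis gcmA : gcm A.
Implicit Types x y : 'rV[int]_n.
Local Notation e := (@simple_root n).
Local Notation p := (fun i x => cartan_pairing A (e i) x).

Lemma srefl_sum i (L : seq 'rV[int]_n) :
  srefl A i (\sum_(x <- L) x) = \sum_(x <- map (srefl A i) L) x.
Proof.
elim: L => [|x L IH]; last by rewrite !big_cons sreflD IH.
by rewrite !big_nil -[X in srefl A i X](scale0r 0) sreflZ scale0r.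
Qed.

(** u is the sum of the positive real roots. As s_i permutes those other than alpha_i, their sum
    pairs to 0 with the i-th simple coroot, and alpha_i contributes 2. *)
Lemma finite_pos_roots_dominant : finitely_many (pos_root A) ->
  exists u : 'rV[int]_n, forall i, 0 < u 0 i /\ 0 < cartan_pairing A (e i) u.
Proof.
move=> [L0 L0P].
pose L := undup [seq x <- L0 | `[< pos_root A x >]].
have LP x : (x \in L) = `[< pos_root A x >].
  by rewrite mem_undup mem_filter; case: asboolP => //= /L0P ->.
have uL : uniq L by apply: undup_uniq.
exists (\sum_(x <- L) x) => i.
have iL : e i \in L by rewrite LP; apply/asboolP; apply: simple_pos_root.
pose L' := rem (e i) L.
have L'P x : (x \in L') = (x != e i) && `[< pos_root A x >].
  by rewrite /L' rem_filter // mem_filter /= LP.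
have pL : perm_eq L (e i :: L') by apply: perm_to_rem.
have pL' : perm_eq (map (srefl A i) L') L'.
  have uL' : uniq L' by apply: rem_uniq.
  apply: uniq_perm => //.
    by rewrite map_inj_uniq //; apply: inv_inj (sreflK gcmA i).
  have sL' y : y \in L' -> srefl A i y \in L'.
    rewrite !L'P => /andP[yi /asboolP py]; apply/andP; split; last first.
      by apply/asboolP; apply: srefl_pos_root.
    apply/eqP => se; have := pos_root_neq0 gcmA py; apply/negP; rewrite negbK.
    have yE : y = - e i by rewrite -[y](sreflK gcmA i) se srefl_simple.
    by apply/eqP/(nneg_anti py.2); rewrite yE opprK; case: (simple_pos_root A i).
  move=> x; apply/mapP/idP => [[y yL ->]|xL]; first exact: sL'.
  by exists (srefl A i x); rewrite ?sreflK ?sL'.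
rewrite !(perm_big _ pL) /= !big_cons cartan_pairingDr cartan_pairing_simple.
have -> : cartan_pairing A (e i) (\sum_(x <- L') x) = 0.
  have := srefl_sum i L'; rewrite (perm_big _ pL') /= => /rowP/(_ i).
  rewrite sreflE eqxx mulr1 => /eqP.
  by rewrite -subr_eq0 addrAC subrr add0r oppr_eq0 => /eqP.
rewrite gcm_diag //; split=> //; rewrite mxE [X in X + _]mxE !eqxx.
apply: ltr_wpDr => //; rewrite summxE big_seq; apply: sumr_ge0 => x.
by rewrite L'P => /andP[_ /asboolP[_ x0]]; apply: x0.
Qed.

End FiniteType.

(** * Nonnegative real vectors and the finite type condition *)

Section RealForm.
Variables (R : realType) (n : nat) (A : 'M[int]_n).
Hypothesis gcmA : gcm A.
Local Notation AR := (map_mx intr A : 'M[R]_n).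
Local Notation e := (@simple_root n).

Lemma gcm_map_mulE (v : 'cV[R]_n) i :
  (AR *m v) i 0 = \sum_j (A i j)%:~R * v j 0.
Proof. by rewrite mxE; apply: eq_bigr => j _; rewrite mxE. Qed.

(** The diagonal term of (A v)_i vanishes and the other terms are nonpositive; if their sum is also
    nonnegative, each of them vanishes. *)
Lemma zero_coordinate (v : 'cV[R]_n) i : (forall j, 0 <= v j 0) -> v i 0 = 0 ->
  (AR *m v) i 0 <= 0 /\
  (0 <= (AR *m v) i 0 -> forall j, v j 0 != 0 -> A i j = 0).
Proof.
move=> v0 vi.
have t j : (A i j)%:~R * v j 0 <= 0.
  have [->|ji] := eqVneq j i; first by rewrite vi mulr0.
  apply: mulr_le0_ge0 => //; rewrite lerz0; apply: gcm_offdiag => //.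
  by rewrite eq_sym.
rewrite gcm_map_mulE; split=> [|s0 j vj]; first exact: sumr_le0.
have sum0 : \sum_j - ((A i j)%:~R * v j 0) = 0.
  apply/eqP; rewrite eq_le sumrN oppr_le0 s0 oppr_ge0; exact: sumr_le0.
have tN k : true -> 0 <= - ((A i k)%:~R * v k 0) by rewrite oppr_ge0 t.
have /eqP := psumr_eq0P tN sum0 (i := j) isT.
by rewrite oppr_eq0 mulf_eq0 (negPf vj) orbF intr_eq0 => /eqP.
Qed.

Hypothesis indA : indecomposable A.

(** By [zero_coordinate] the zero set of v is decoupled from its complement, so indecomposability
    makes it empty or everything. *)
Lemma nneg_subharmonic (v : 'cV[R]_n) :
  (forall j, 0 <= v j 0) -> (forall i, v i 0 = 0 -> 0 <= (AR *m v) i 0) ->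
  (forall i, 0 < v i 0) \/ v = 0.
Proof.
move=> v0 Av.
have [i j|E|E] := indA (J := [set i | v i 0 == 0]).
- rewrite !inE => /eqP vi vj.
  have ij := (zero_coordinate v0 vi).2 (Av i vi) j vj.
  by split=> //; apply: gcm_eq0 ij.
- left=> i; rewrite lt_neqAle v0 andbT eq_sym; apply/negP => vi.
  by have := finset.in_set0 i; rewrite -E inE vi.
- right; apply/colP => i; rewrite mxE; apply/eqP.
  by have := finset.in_setT i; rewrite -E inE.
Qed.

(** The least ratio t of v to u is the largest t for which v - t u is nonnegative; this difference
    vanishes at i. *)
Lemma min_ratio (u v : 'cV[R]_n) (i0 : 'I_n) : (forall i, 0 < u i 0) ->
  exists i, forall j, 0 <= v j 0 - (v i 0 / u i 0) * u j 0.
Proof.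
move=> u0.
have [i _ imin] := @arg_minP _ _ _ i0 predT (fun i => v i 0 / u i 0) isT.
by exists i => j; rewrite subr_ge0 -ler_pdivlMr // imin.
Qed.

Lemma finite_type_of_positive (u : 'cV[R]_n) :
  (forall i, 0 < u i 0) -> (forall i, 0 < (AR *m u) i 0) -> finite_type R A.
Proof.
move=> u0 Au.
have third (v : 'cV[R]_n) : (forall i, 0 <= (AR *m v) i 0) ->
    (forall i, 0 < v i 0) \/ v = 0.
  move=> Av; have [i0 _|no] := pickP 'I_n; last first.
    by right; apply/colP => i; have := no i.
  have [i imin] := min_ratio v i0 u0; apply: nneg_subharmonic => // j.
  set t := v i 0 / u i 0 in imin.
  have t0 : 0 <= t.
    (* For t < 0, v - t u would be nonnegative with a zero at i although A (v - t u) is positive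
       there. *)
    rewrite leNgt; apply/negP => tneg.
    pose v' := v - t *: u.
    have v'0 k : 0 <= v' k 0 by have := imin k; rewrite !mxE.
    have v'i : v' i 0 = 0 by rewrite !mxE /t divfK ?subrr // gt_eqF.
    have := (zero_coordinate v'0 v'i).1.
    rewrite mulmxBr -scalemxAr mxE [X in _ + X]mxE [X in - X]mxE leNgt => /negP; apply.
    by rewrite -mulNr; apply: ltr_wpDl => //; rewrite mulr_gt0 // oppr_gt0.
  by apply: le_trans (mulr_ge0 t0 (ltW (u0 j))) _; rewrite -subr_ge0.
split=> //; last by exists u.
have : \det AR^T != 0.
  apply/negP => /det0P [v vn0 vA].
  have Av : AR *m v^T = 0 by rewrite -[AR]trmxK -trmx_mul vA trmx0.
  have vN (w : 'cV[R]_n) : AR *m w = 0 -> forall i, 0 <= w i 0.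
    move=> w0 i; have [|/(_ i)/ltW//|->] := third w; last by rewrite mxE.
    by move=> j; rewrite w0 mxE.
  case/eqP: vn0; apply/rowP => i; rewrite mxE; apply/eqP; rewrite eq_le.
  have := vN _ Av i; rewrite mxE => ->; rewrite andbT.
  by have := vN (- v^T); rewrite mulmxN Av oppr0 => /(_ erefl i); rewrite !mxE oppr_ge0.
by rewrite det_tr det_map_mx intr_eq0.
Qed.

End RealForm.

(** * The invariant form *)

Definition symmetrizer (R : realType) n (A : 'M[int]_n) (d : 'I_n -> R) :=
  (forall i, 0 < d i) /\
  forall i j, d i * (A i j)%:~R = d j * (A j i)%:~R.

Lemma symmetrizable_symmetrizer (R : realType) n (A : 'M[int]_n) :
  symmetrizable A -> exists d : 'I_n -> R, symmetrizer A d.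
Proof.
move=> [d [d0 /= dA]]; exists (fun i => ratr (d 0 i)); split=> [i|i j].
  by rewrite ltr0q.
move/matrixP: dA => /(_ j i); rewrite mxE !mul_diag_mx !mxE => /(congr1 (@ratr R)).
by rewrite !rmorphM /= !ratr_int.
Qed.

Section InvariantForm.
Variables (R : realType) (n : nat) (A : 'M[int]_n) (d : 'I_n -> R).
Hypotheses (gcmA : gcm A) (symA : symmetrizer A d).
Implicit Types x y z : 'rV[int]_n.
Local Notation AR := (map_mx intr A : 'M[R]_n).
Local Notation e := (@simple_root n).
Local Notation act := (weyl_act A).

(** The standard invariant form, with (alpha_i | alpha_j) = d_i a_ij. *)
Definition root_form x y : R :=
  \sum_i d i * (x 0 i)%:~R * (cartan_pairing A (e i) y)%:~R.

Lemma root_formE x y :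
  root_form x y = \sum_i \sum_j d i * (A i j)%:~R * (x 0 i)%:~R * (y 0 j)%:~R.
Proof.
apply: eq_bigr => i _; rewrite cartan_pairing_row raddf_sum mulr_sumr.
by apply: eq_bigr => j _; rewrite /= intrM; ring.
Qed.

Lemma root_formC x y : root_form x y = root_form y x.
Proof.
rewrite !root_formE exchange_big; apply: eq_bigr => i _; apply: eq_bigr => j _ /=.
by rewrite symA.2; ring.
Qed.

Lemma root_formDl x y z : root_form (x + y) z = root_form x z + root_form y z.
Proof.
by rewrite -big_split; apply: eq_bigr => i _; rewrite mxE intrD /=; ring.
Qed.

Lemma root_formZl (k : int) x z : root_form (k *: x) z = k%:~R * root_form x z.
Proof.
by rewrite mulr_sumr; apply: eq_bigr => i _; rewrite mxE intrM /=; ring.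
Qed.

Lemma root_formBl x y z : root_form (x - y) z = root_form x z - root_form y z.
Proof. by rewrite root_formDl -scaleN1r root_formZl mulN1r. Qed.

Lemma root_formZr (k : int) x z : root_form x (k *: z) = k%:~R * root_form x z.
Proof. by rewrite root_formC root_formZl root_formC. Qed.

Lemma root_formBr x y z : root_form x (y - z) = root_form x y - root_form x z.
Proof. by rewrite root_formC root_formBl root_formC [root_form z x]root_formC. Qed.

Lemma root_form_simple i y : root_form (e i) y = d i * (cartan_pairing A (e i) y)%:~R.
Proof.
rewrite /root_form (bigD1 i) //= big1 => [|j /negPf ji]; rewrite mxE !eqxx ?ji /=.
  by rewrite mulr1 addr0.
by rewrite mulr0 mul0r.
Qed.

Lemma root_form_srefl i x y : root_form (srefl A i x) (srefl A i y) = root_form x y.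
Proof.
rewrite /srefl root_formBl !root_formBr !root_formZl !root_formZr.
rewrite [root_form x (e i)]root_formC !root_form_simple.
by rewrite cartan_pairing_simple gcm_diag //; ring.
Qed.

Lemma root_form_act w x y : root_form (act w x) (act w y) = root_form x y.
Proof. by elim: w => //= i w IH; rewrite root_form_srefl. Qed.

(* [w] is a word for the reflection in a, and [k x] is the integer <a^vee, x>. *)
Lemma real_root_reflection (a : 'rV[int]_n) : real_root A a ->
  exists (w : seq 'I_n) (N : R) (k : 'rV[int]_n -> int),
    [/\ 0 < N, N <= \sum_i d i, root_form a a = 2 * N &
      forall x, act w x = x - k x *: a /\ root_form a x = N * (k x)%:~R].
Proof.
move=> [w [i ->]]; pose k x := cartan_pairing A (e i) (act (rev w) x).
exists (w ++ i :: rev w), (d i), k; split.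
- exact: symA.1.
- rewrite (bigD1 i) //= lerDl; apply: sumr_ge0 => j _; exact: ltW (symA.1 j).
- by rewrite root_form_act root_form_simple cartan_pairing_simple gcm_diag // mulrC.
- move=> x; split.
    rewrite act_cat /= {1}/srefl actD -scaleN1r !actZ scaleN1r.
    by rewrite act_rev_inv.
  by rewrite -{1}(act_rev_inv gcmA w x) root_form_act root_form_simple.
Qed.

(** Put S_ij = d_i a_ij. After symmetrizing the left side in i and j, the two sides differ by the
    sum of -S_ij (u_j x_i - u_i x_j)^2 / (2 u_i u_j), where S_ij <= 0 off the diagonal. *)
Lemma root_form_ge_squares (u : 'cV[R]_n) x : (forall i, 0 < u i 0) ->
  \sum_i d i * (AR *m u) i 0 / u i 0 * (x 0 i)%:~R ^+ 2 <= root_form x x.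
Proof.
move=> u0.
pose S i j := d i * (A i j)%:~R.
have SC i j : S i j = S j i by apply: symA.2.
have -> : \sum_i d i * (AR *m u) i 0 / u i 0 * (x 0 i)%:~R ^+ 2 =
    \sum_i \sum_j S i j * (u j 0 / u i 0 * (x 0 i)%:~R ^+ 2).
  apply: eq_bigr => i _; rewrite gcm_map_mulE mulr_sumr !mulr_suml.
  by apply: eq_bigr => j _; rewrite /S; ring.
pose F i j := S i j * (u j 0 / u i 0 * (x 0 i)%:~R ^+ 2).
rewrite -[X in X <= _]/(\sum_i \sum_j F i j).
have -> : \sum_i \sum_j F i j = \sum_i \sum_j (F i j + F j i) / 2.
  under [RHS]eq_bigr do rewrite -mulr_suml big_split /=.
  by rewrite -mulr_suml big_split /= [X in _ + X]exchange_big /=; field.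
rewrite root_formE; apply: ler_sum => i _; apply: ler_sum => j _.
rewrite -mulrA -[d i * _]/(S i j) /F [S j i]SC -mulrDr -mulrA.
have uj : u j 0 != 0 by rewrite gt_eqF.
have [->|ij] := eqVneq i j.
  by rewrite le_eqVlt; apply/orP; left; apply/eqP; field.
have ui : u i 0 != 0 by rewrite gt_eqF.
apply: ler_wnM2l.
  rewrite /S; apply: mulr_ge0_le0; first exact: ltW (symA.1 i).
  by rewrite lerz0; apply: gcm_offdiag.
move: (x 0 i)%:~R (x 0 j)%:~R => s t; rewrite -subr_ge0.
have -> : (u j 0 / u i 0 * s ^+ 2 + u i 0 / u j 0 * t ^+ 2) / 2 - s * t =
   (u j 0 * s - u i 0 * t) ^+ 2 / (2 * u i 0 * u j 0) by field; rewrite ui uj.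
by rewrite divr_ge0 ?sqr_ge0 // !mulr_ge0 // ltW.
Qed.

(** By [root_form_ge_squares] the form is positive definite, while (x | x) is at most twice the sum
    of the d_i on real roots, so their coordinates are bounded. *)
Lemma finite_type_pos_roots : finite_type R A -> finitely_many (pos_root A).
Proof.
move=> [_ [u [u0 Au]] _].
pose c i := d i * (AR *m u) i 0 / u i 0.
have c0 i : 0 < c i by rewrite /c divr_gt0 // mulr_gt0 // symA.1.
pose D := \sum_i d i.
have D0 : 0 <= D by apply: sumr_ge0 => i _; exact: ltW (symA.1 i).
(* The sum dominates each bound 2 D / c_j on the square of the j-th coordinate, so one N serves all
   coordinates. *)
pose N := (Num.truncn (\sum_i 2 * D / c i)).+1.
apply: finitely_many_sub (finitely_many_box n N) => x [/real_root_reflection].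
move=> [_ [N0 [_ [_ N0D xx _]]]] _ j.
have cj : c j * (x 0 j)%:~R ^+ 2 <= 2 * D.
  apply: le_trans (_ : root_form x x <= _); last by rewrite xx ler_pM2l.
  apply: le_trans (root_form_ge_squares x u0); rewrite (bigD1 j) //= lerDl.
  by apply: sumr_ge0 => i _; rewrite mulr_ge0 ?sqr_ge0 // ltW // c0.
have le1 : (x 0 j)%:~R ^+ 2 <= \sum_i 2 * D / c i.
  apply: le_trans (_ : 2 * D / c j <= _); first by rewrite ler_pdivlMr // mulrC.
  rewrite [leRHS](bigD1 j) //= lerDl; apply: sumr_ge0 => i _.
  by apply: divr_ge0; [apply: mulr_ge0 | apply: ltW (c0 i)].
have : (x 0 j)%:~R ^+ 2 < N%:R :> R.
  by apply: le_lt_trans le1 _; apply: truncnS_gt.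
rewrite expr2 -intrM -[N%:R]/((N%:Z)%:~R) ltr_int.
by move: (x 0 j) (N%:Z) => z M zM; case: (ger0P z) => z0; nia.
Qed.

End InvariantForm.

(** * A compactness argument *)

Section Compactness.
Import numFieldNormedType.Exports.
Local Open Scope classical_set_scope.

Lemma continuous_sum (R : realType) (T : topologicalType) (I : finType)
    (f : I -> T -> R) :
  (forall i, continuous (f i)) -> continuous (fun x => \sum_i f i x).
Proof.
move=> cf x; elim: (index_enum I) => [|i s IH].
  have -> : (fun y => \sum_(j <- [::]) f j y) = cst 0.
    by apply/funext => y; rewrite big_nil.
  exact: cst_continuous.
have -> : (fun y => \sum_(j <- i :: s) f j y) = f i \+ (fun y => \sum_(j <- s) f j y).
  by apply/funext => y; rewrite big_cons.
by apply: continuousD IH; apply: cf.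
Qed.

Lemma continuous_linear_form (R : realType) m (c : 'I_m -> R) :
  continuous (fun v : 'rV[R]_m => \sum_j v 0 j * c j).
Proof.
apply: continuous_sum => j x; apply: continuousM; last exact: cst_continuous.
exact: coord_continuous.
Qed.

(** Scaling g to coordinate sum 1 puts it into a compact part S of the simplex, where the sum of the
    |(A v)_i| attains its minimum; the hypothesis forces this minimum to be 0. *)
Lemma simplex_kernel (R : realType) m n (A : 'M[R]_m) (Q : 'M[R]_(m, n)) :
  (forall eps : R, 0 < eps -> exists g : 'rV[R]_m,
    [/\ forall j, 0 <= g 0 j, 0 < \sum_j g 0 j, forall l, 0 <= (g *m Q) 0 l &
        forall i, `|(A *m g^T) i 0| <= eps * \sum_j g 0 j]) ->
  exists v : 'rV[R]_m,
    [/\ forall j, 0 <= v 0 j, \sum_j v 0 j = 1, forall l, 0 <= (v *m Q) 0 l &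
        A *m v^T = 0].
Proof.
move=> approx.
(* The factor 1 gives the sum the shape required by [continuous_linear_form]. *)
pose S := [set v : 'rV[R]_m | [/\ forall j, 0 <= v 0 j, \sum_j v 0 j * 1 = 1 &
  forall l, 0 <= \sum_j v 0 j * Q j l]].
have normalize (eps : R) : 0 < eps -> exists2 v, S v &
    forall i, `|\sum_j v 0 j * A i j| <= eps.
  move=> /approx [g [g0 gs gQ gA]]; set s := \sum_j _ in gs gA.
  have sn0 : s != 0 by rewrite gt_eqF.
  exists (s^-1 *: g); first split.
  - by move=> j; rewrite mxE mulr_ge0 // invr_ge0 ltW.
  - transitivity (s^-1 * s); last by rewrite mulVf.
    by rewrite mulr_sumr; apply: eq_bigr => j _; rewrite mxE mulr1.
  - move=> l; under eq_bigr do rewrite mxE -mulrA; rewrite -mulr_sumr.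
    apply: mulr_ge0; first by rewrite invr_ge0 ltW.
    by have := gQ l; rewrite mxE.
  - move=> i; under eq_bigr do rewrite mxE -mulrA; rewrite -mulr_sumr normrM.
    rewrite gtr0_norm ?invr_gt0 // mulrC ler_pdivrMr //.
    have := gA i; rewrite mxE; congr (`| _ | <= _).
    by apply: eq_bigr => j _; rewrite mxE mulrC.
have closedS : closed S.
  have -> : S = \bigcap_(j in [set: 'I_m]) [set v : 'rV[R]_m | 0 <= v 0 j] `&`
    [set v : 'rV[R]_m | \sum_j v 0 j * 1 = 1] `&`
    \bigcap_(l in [set: 'I_n]) [set v : 'rV[R]_m | 0 <= \sum_j v 0 j * Q j l].
    apply/seteqP; split=> [v [a b c]|v [[a b] c]].
      by split; [split=> // j _; apply: a | move=> l _; apply: c].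
    by split=> // [j|l]; [apply: a | apply: c].
  have cl (g : 'rV[R]_m -> R) (D : set R) :
      continuous g -> closed D -> closed [set v | D (g v)].
    by move=> cg; apply: preimage_closed => v _; apply: cg.
  apply: closedI; first apply: closedI.
  - apply: closed_bigI => j _.
    exact: cl _ _ (@coord_continuous _ _ _ _ _) (@closed_ge _ (0 : R)).
  - apply: (cl (fun v => \sum_j v 0 j * 1) [set x | x = 1]); last exact: closed_eq.
    exact (@continuous_linear_form R m (fun=> 1)).
  - apply: closed_bigI => l _.
    apply: (cl (fun v => \sum_j v 0 j * Q j l) [set x | 0 <= x]); last exact: closed_ge.
    exact: continuous_linear_form.
have compactS : compact S.
  apply: (subclosed_compact closedS
    (@rV_compact _ _ (fun=> `[0 : R, 1]%classic) (fun=> @segment_compact _ _ _))).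
  move=> v [v0 v1 _] i /=; rewrite in_itv /= v0 /= -v1 (bigD1 i) //= mulr1 lerDl.
  by apply: sumr_ge0 => j _; rewrite mulr1.
pose f (v : 'rV[R]_m) := \sum_i `|\sum_j v 0 j * A i j|.
have cf : continuous f.
  apply: continuous_sum => i x; apply: continuous_comp; last exact: norm_continuous.
  exact: continuous_linear_form.
have S0 : S !=set0 by have [v Sv _] := normalize 1 ltr01; exists v.
have [v vS vmin] := compact_EVT_min S0 compactS (continuous_subspaceT cf).
have fv0 : f v = 0.
  apply/eqP; rewrite eq_le sumr_ge0 ?andbT //; apply/ler_addgt0Pl => eps eps0.
  rewrite addr0; have e0 : 0 < eps / m.+1%:R by rewrite divr_gt0.
  have [w wS wA] := normalize _ e0.
  apply: le_trans (vmin w (mem_set wS)) _.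
  apply: le_trans (_ : \sum_(i < m) eps / m.+1%:R <= _); first exact: ler_sum.
  rewrite sumr_const card_ord -[_ *+ m]mulr_natr -mulrA ler_piMr ?(ltW eps0) // mulrC.
  by rewrite ler_pdivrMr // mul1r ler_nat.
move: vS; rewrite inE => -[v0 v1 vQ]; exists v; split=> //.
- by rewrite -v1; apply: eq_bigr => j _; rewrite mulr1.
- by move=> l; rewrite mxE.
- apply/colP => i; rewrite !mxE.
  have /normr0_eq0 vA := psumr_eq0P (fun i _ => normr_ge0 _) fv0 (i := i) isT.
  by rewrite -[RHS]vA; apply: eq_bigr => j _; rewrite mxE mulrC.
Qed.

End Compactness.

(** * Embeddings of root systems *)

Lemma finitely_many_inj (T U : eqType) (f : T -> U) (P : U -> Prop) :
  injective f -> finitely_many P -> finitely_many (fun x => P (f x)).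
Proof.
move=> f_inj [L PL].
suff [L' fL'] : exists L' : seq T, forall x, f x \in L -> x \in L'.
  by exists L' => x /PL /fL'.
elim: L {PL} => [|y L [L' IH]]; first by exists [::].
have [[x fx]|nx] := pselect (exists x, f x = y).
  exists (x :: L') => z; rewrite !inE -fx (inj_eq f_inj).
  by case: eqP => //= _ /IH.
exists L' => z; rewrite inE => /orP[/eqP fz|/IH //].
by case: nx; exists z.
Qed.

Section RootEmbedding.
Variables (n m : nat) (A : 'M[int]_n) (B : 'M[int]_m).
Hypotheses (gcmA : gcm A) (gcmB : gcm B).
Implicit Types x y : 'rV[int]_m.
Local Notation e := (@simple_root m).

Definition root_embedding (M : 'M[int]_(m, n)) :=
  [/\ injective (mulmx^~ M : 'rV[int]_m -> 'rV[int]_n),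
      forall i, real_root A (e i *m M) &
      forall i, exists w, forall x, srefl B i x *m M = weyl_act A w (x *m M)].

(** Exchanges the roots with positive and with negative image, so that one-sided results apply to
    both families. *)
Lemma root_embeddingN M : root_embedding M -> root_embedding (- M).
Proof.
move=> [inj rr refl]; split=> [x y|i|i].
- by rewrite !mulmxN => /oppr_inj /inj.
- by rewrite mulmxN; apply: real_rootN.
- by have [w wE] := refl i; exists w => x; rewrite !mulmxN wE actN.
Qed.

Variable M : 'M[int]_(m, n).
Hypothesis embM : root_embedding M.
Local Notation q := (mulmx^~ M).

Lemma embedding_act w : exists w', forall x, q (weyl_act B w x) = weyl_act A w' (q x).
Proof.
elim: w => [|i w [w' IH]]; first by exists [::].
have [_ _ /(_ i) [wi E]] := embM.
by exists (wi ++ w') => x; rewrite /= E IH act_cat.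
Qed.

Lemma embedding_real_root x : real_root B x -> real_root A (q x).
Proof.
move=> [w [i ->]]; have [w' ->] := embedding_act w.
by apply: act_real_root; case: embM.
Qed.

Lemma embedding_sign x : real_root B x -> nneg (q x) \/ nneg (- q x).
Proof. by move=> /embedding_real_root; apply: real_root_sign. Qed.

Lemma embedding_not_both x : real_root B x -> nneg (q x) -> ~ nneg (- q x).
Proof.
move=> /embedding_real_root /(real_root_neq0 gcmA) /negP q0 qx nqx.
by apply: q0; rewrite (nneg_anti qx nqx).
Qed.

(** Some w' in W(A) induces w, so these roots map injectively into the finite set of inversions of
    w'. *)
Lemma finitely_many_embedding_inversions w :
  finitely_many (fun x => [/\ real_root B x, nneg (q x) & nneg (- q (weyl_act B w x))]).
Proof.
have [w' w'E] := embedding_act w.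
have [inj _ _] := embM.
apply: finitely_many_sub (finitely_many_inj inj (finitely_many_inversions gcmA w')).
move=> x [/embedding_real_root rx qx nx]; split; first by split.
by rewrite -w'E.
Qed.

(* Replacing w by w s_i when w maps the i-th simple root to a negative root
   removes one element from the finite set of inverted roots. *)
Lemma finite_inversions_conjugate :
  finitely_many (fun x => pos_root B x /\ nneg (- q x)) ->
  exists w, forall i, nneg (weyl_act A w (q (e i))).
Proof.
move=> [L LP].
suff [w wP] : exists w, forall i, nneg (q (weyl_act B w (e i))).
  by have [w' w'E] := embedding_act w; exists w' => i; rewrite -w'E.
have {LP} LP x : pos_root B x -> nneg (- q (weyl_act B [::] x)) -> x \in L.
  by move=> px nx; apply: LP.
have [N] := ubnP (size L); elim: N L [::] LP => // N IH L w LP.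
rewrite ltnS => LN.
have [wP|] := pselect (forall i, nneg (q (weyl_act B w (e i)))); first by exists w.
move=> /existsNP [i /=]; set y := q _ => ny.
have wr : real_root B (weyl_act B w (e i)) by apply/act_real_root/simple_real_root.
have {}ny : nneg (- y) by case: (embedding_sign wr).
have iL : e i \in L by apply: LP ny; apply: simple_pos_root.
apply: (IH (map (srefl B i) [seq x <- L | x != e i]) (rcons w i)); last first.
  rewrite size_map size_filter; apply: leq_trans LN.
  rewrite ltn_neqAle count_size andbT -all_count.
  by apply/negP => /allP/(_ _ iL); rewrite /= eqxx.
move=> x px; rewrite act_rcons => nx.
have xi : x != e i.
  apply/eqP => xi; apply: (embedding_not_both wr) ny.
  by move: nx; rewrite xi srefl_simple // actN mulNmx opprK.
have ps := srefl_pos_root gcmB px xi.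
apply/mapP; exists (srefl B i x); last by rewrite sreflK.
rewrite mem_filter /= (LP _ ps nx) andbT; apply/eqP => si.
have xE : x = - e i by rewrite -[x](sreflK gcmB i) si srefl_simple.
have /negP := pos_root_neq0 gcmB px; apply; apply/eqP/(nneg_anti px.2).
by rewrite xE opprK; case: (simple_pos_root B i).
Qed.

End RootEmbedding.

(** * The dichotomy *)

Lemma nneg_form_bound (R : realType) m (c : 'I_m -> R) (x : 'rV[int]_m) : nneg x ->
  `|\sum_j c j * (x 0 j)%:~R| <= (\sum_j `|c j|) * (height x)%:~R.
Proof.
move=> x0; apply: le_trans (ler_norm_sum _ _ _) _; rewrite mulr_suml.
apply: ler_sum => j _; rewrite normrM ler_wpM2l // ger0_norm ?ler0z // ler_int.
exact: nneg_height_ge.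
Qed.

Lemma height_mulmx n m (M : 'M[int]_(m, n)) (x : 'rV[int]_m) :
  height (x *m M) = \sum_j (\sum_l M j l) * x 0 j.
Proof.
rewrite /height; under eq_bigr do rewrite mxE.
rewrite exchange_big; apply: eq_bigr => j _ /=; rewrite mulr_suml.
by apply: eq_bigr => l _; rewrite mulrC.
Qed.

(** A right inverse of M over R expresses the height of x as a linear form in the coordinates of x
    M. *)
Lemma height_le_embedded (R : realType) n m (M : 'M[int]_(m, n)) :
  row_free (map_mx intr M : 'M[R]_(m, n)) ->
  exists2 K : R, 0 < K & forall x : 'rV[int]_m, nneg (x *m M) ->
    `|(height x)%:~R| <= K * (height (x *m M))%:~R.
Proof.
move=> /row_freeP [N MN].
pose r l := \sum_j N l j.
exists (1 + \sum_l `|r l|); first by rewrite ltr_pwDl // sumr_ge0.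
move=> x qx.
have -> : (height x)%:~R = \sum_l r l * ((x *m M) 0 l)%:~R :> R.
  have xE j : (x 0 j)%:~R = \sum_l ((x *m M) 0 l)%:~R * N l j :> R.
    have : map_mx intr x *m (map_mx intr M *m N) = map_mx intr x :> 'rV[R]_m.
      by rewrite MN mulmx1.
    rewrite mulmxA -map_mxM => /rowP/(_ j); rewrite [in RHS]mxE => <-.
    by rewrite mxE; apply: eq_bigr => l _; rewrite mxE.
  rewrite /height raddf_sum; under eq_bigr do rewrite /= xE.
  rewrite exchange_big; apply: eq_bigr => l _ /=.
  by rewrite mulr_suml; apply: eq_bigr => j _; rewrite mulrC.
apply: le_trans (nneg_form_bound r qx) _.
by apply: ler_wpM2r; rewrite ?lerDr // ler0z; apply: nneg_height_ge0.
Qed.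

Section Dichotomy.
Variables (R : realType) (n m : nat) (A : 'M[int]_n) (B : 'M[int]_m).
Variable d : 'I_m -> R.
Hypotheses (gcmA : gcm A) (gcmB : gcm B) (symB : symmetrizer B d).
Hypothesis indB : indecomposable B.
Implicit Types x y g : 'rV[int]_m.
Local Notation BR := (map_mx intr B : 'M[R]_m).
Local Notation e := (@simple_root m).
Local Notation p := (fun i x => cartan_pairing B (e i) x).
Local Notation bf := (root_form B d).

(** * Estimates on roots with negative and with positive image *)

Section OneSide.
Variable M : 'M[int]_(m, n).
Hypothesis embM : root_embedding A B M.
Hypothesis freeM : row_free (map_mx intr M : 'M[R]_(m, n)).
Local Notation q := (mulmx^~ M).
Local Notation D := (fun x => pos_root B x /\ nneg (- q x)).
Local Notation E := (fun x => pos_root B x /\ nneg (q x)).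

(* The reflection s_a g = g - k a, k = <a^vee, g>, is again nonnegative, and so is
   its image; taking heights, the former bounds k from above and the latter, as a
   has negative image, from below. *)
Lemma form_bound : exists2 C : R, 0 <= C & forall a, D a ->
  finitely_many (fun g => E g /\
    C * (height g)%:~R < `|bf a g| * (height a)%:~R).
Proof.
have [K K0 KP] := height_le_embedded freeM.
pose C0 : R := \sum_j `|(\sum_l M j l)%:~R|.
have C00 : 0 <= C0 by apply: sumr_ge0.
have C0P x : nneg x -> (height (q x))%:~R <= C0 * (height x)%:~R.
  move=> x0; apply: le_trans (le_trans (ler_norm _) (nneg_form_bound _ x0)).
  by rewrite height_mulmx raddf_sum /=; under eq_bigr do rewrite intrM.
pose S := \sum_i d i.
have S0 : 0 <= S by apply: sumr_ge0 => i _; exact: ltW (symB.1 i).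
(* S bounds the factor N between (a | g) and k; the summands 1 and K C0 come from the upper and the
   lower bound on k. *)
exists (S * (1 + K * C0)) => [|a [pa na]].
  by rewrite mulr_ge0 // addr_ge0 // mulr_ge0 // ltW.
have [w [N [k [N0 NS _ wk]]]] := real_root_reflection gcmB symB pa.1.
(* The discarded g are those for which s_a g becomes negative in B or in A. *)
apply: finitely_many_sub (finitely_many_or (finitely_many_inversions gcmB w)
  (finitely_many_embedding_inversions gcmA embM w)) => g [[pg qg] lt].
apply: contrapT => /not_orP [ng nqg].
have rwg : real_root B (weyl_act B w g) by apply: act_real_root; case: pg.
have wg : nneg (weyl_act B w g).
  by have [//|nw] := real_root_sign gcmB rwg; case: ng.
have qwg : nneg (q (weyl_act B w g)).
  by have [//|nw] := embedding_sign gcmA embM rwg; case: nqg; split=> //; case: pg.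
move: lt; rewrite (wk g).2 ltNge => /negP; apply.
have h1 := nneg_height_ge0 wg; have h2 := nneg_height_ge0 qwg.
move: h1 h2; rewrite (wk g).1 mulmxBl -scalemxAl -!scaleN1r !(heightD, heightZ).
rewrite !mulN1r !subr_ge0 => h1 h2.
have ha : 0 < (height a)%:~R :> R by rewrite ltr0z (pos_root_height gcmB pa).
have hg : 0 < (height g)%:~R :> R by rewrite ltr0z (pos_root_height gcmB pg).
have hKa : (height a)%:~R <= K * - (height (q a))%:~R :> R.
  have := KP (- a); rewrite mulNmx => /(_ na).
  by rewrite !heightN !rmorphN normrN gtr0_norm.
have h3 : (k g)%:~R * (height a)%:~R <= (height g)%:~R :> R.
  by rewrite -intrM ler_int.
have h4 : - (k g)%:~R * - (height (q a))%:~R <= C0 * (height g)%:~R.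
  apply: le_trans (C0P _ pg.2); rewrite mulrNN -intrM ler_int.
  exact: h2.
move: ha hg hKa h3 h4; move: (k g)%:~R (height a)%:~R (height g)%:~R.
move: (height (q a))%:~R => b z H G ha hg hKa h3 h4.
suff zH : `|z| * H <= (1 + K * C0) * G.
  rewrite normrM gtr0_norm // -!mulrA.
  apply: (le_trans (ler_wpM2r (mulr_ge0 (normr_ge0 z) (ltW ha)) NS)).
  exact: ler_wpM2l.
have KC0 : 0 <= K * C0 by rewrite mulr_ge0 // ltW.
have [z0|z0] := leP 0 z.
  rewrite ger0_norm // mulrDl mul1r; apply: (le_trans h3); rewrite lerDl.
  by rewrite mulr_ge0 // ltW.
rewrite ltr0_norm // mulrDl mul1r -mulrA.
apply: (le_trans (ler_wpM2l _ hKa)); first by rewrite oppr_ge0 ltW.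
rewrite mulrCA; apply: (le_trans (ler_wpM2l (ltW K0) h4)).
by rewrite lerDr ltW.
Qed.

(** Apart from alpha_i, a root x leaves D under s_i only if its negative image becomes positive;
    then -x is one of the finitely many embedded inversions of s_i. *)
Lemma finitely_many_sign_change i :
  finitely_many (fun x => D x /\ ~ D (srefl B i x)).
Proof.
have opp_inj : injective (fun x => - x) by apply: oppr_inj.
apply: finitely_many_sub (finitely_many_or (finitely_many_or
  (ex_intro _ [:: e i] (fun x (xi : x = e i) => _ : x \in [:: e i]))
  (finitely_many_inversions gcmB [:: i]))
  (finitely_many_inj opp_inj
    (finitely_many_embedding_inversions gcmA embM [:: i]))) => [x|]; last first.
  by move=> x ->; rewrite inE.
move=> [[px nx] ns]; have [->|xi] := eqVneq x (e i); first by left; left.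
have ps := srefl_pos_root gcmB px xi.
right; split; first by apply: real_rootN; case: px.
  by rewrite mulNmx.
rewrite actN mulNmx opprK /=.
by have [//|nq] := embedding_sign gcmA embM ps.1; case: ns.
Qed.

Hypothesis infD : ~ finitely_many D.

(* If almost all elements of D are orthogonal to alpha_j, then so are their images
   under s_k, hence almost all are orthogonal to alpha_k when a_jk is nonzero. *)
Lemma infinitely_many_noninvariant i : ~ finitely_many (fun x => D x /\ p i x != 0).
Proof.
pose Z i := finitely_many (fun x => D x /\ p i x != 0).
have prop j k : Z j -> B j k != 0 -> Z k.
  move=> Zj Bjk.
  apply: finitely_many_sub (finitely_many_or (finitely_many_sign_change k)
    (finitely_many_or Zj (finitely_many_inj (inv_inj (sreflK gcmB k)) Zj))).
  move=> x [Dx pk]; have [Ds|nDs] := pselect (D (srefl B k x)); last by left.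
  right; have [pj|pj] := eqVneq (p j x) 0; [right; split=> // | by left].
  rewrite /srefl cartan_pairingDr -scaleNr cartan_pairingZr cartan_pairing_simple.
  by rewrite pj add0r mulNr oppr_eq0 mulf_neq0.
have [j k|J0|JT] := indB (J := [set i | `[< Z i >]]).
- rewrite !finset.inE => /asboolP Zj /asboolP nZk.
  have jk : B j k = 0 by apply: contra_notP nZk => /eqP; apply: prop.
  by split=> //; apply: gcm_eq0 jk.
- by move=> /(@asboolT (Z i)) Zi; have := finset.in_set0 i; rewrite -J0 finset.inE Zi.
exfalso; apply: infD.
have ZT j : Z j by apply/asboolP; have := finset.in_setT j; rewrite -JT finset.inE.
(* An x in D orthogonal to all simple roots would satisfy (x | x) = 0, but real roots have positive
   square length. *)
apply: finitely_many_sub (finitely_many_all ZT) => x Dx.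
apply: contrapT => nex.
have [_ [N [_ [N0 _ xx _]]]] := real_root_reflection gcmB symB Dx.1.1.
have : bf x x = 0.
  rewrite /root_form big1 // => j _; have -> : p j x = 0; last by rewrite mulr0.
  by apply/eqP/negPn/negP => pj; apply: nex; exists j.
by rewrite xx => /eqP; rewrite mulf_eq0 pnatr_eq0 /= gt_eqF.
Qed.

(** The difference (a | g) - (s_i a | g) equals <alpha_i^vee, a> (alpha_i | g). Take a and s_i a in
    D with the first factor a nonzero integer: [form_bound] at both bounds |<alpha_i^vee, g>| by a
    constant times height(g) / height(a), and a can be chosen as high as desired. *)
Lemma small_pairing (eps : R) : 0 < eps ->
  finitely_many (fun g => E g /\ exists i, eps * (height g)%:~R < `|(p i g)%:~R|).
Proof.
move=> eps0.
suff fin i : finitely_many (fun g => E g /\ eps * (height g)%:~R < `|(p i g)%:~R|).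
  by apply: finitely_many_sub (finitely_many_all fin) => g [Eg [i lt]]; exists i.
have [C C0 CP] := form_bound.
pose C2 : R := 1 + \sum_j `|(B i j)%:~R|.
have C20 : 0 < C2 by rewrite ltr_pwDl // sumr_ge0.
have C2P x : nneg x -> (height (srefl B i x))%:~R <= C2 * (height x)%:~R.
  move=> x0; have le := nneg_form_bound (fun j => (B i j)%:~R : R) x0.
  have -> : height (srefl B i x) = height x - p i x.
    rewrite /srefl -scaleNr heightD heightZ.
    suff -> : height (e i) = 1 by rewrite mulr1.
    rewrite /height (bigD1 i) //= big1 => [|j /negPf ji].
      by rewrite mxE !eqxx addr0.
    by rewrite mxE ji andbF.
  rewrite intrD /C2 mulrDl mul1r lerD2l.
  apply: le_trans le; rewrite rmorphN; apply: le_trans (ler_norm _) _.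
  rewrite normrN cartan_pairing_row raddf_sum /=.
  by under eq_bigr do rewrite intrM.
pose C3 := C * (1 + C2).
have C30 : 0 <= C3 by rewrite mulr_ge0 // addr_ge0 // ltW.
(* Once height(a) exceeds T, the resulting bound is below eps height(g). *)
pose T := C3 / (d i * eps).
have di0 : 0 < d i := symB.1 i.
have [a [Da pa] /not_orP [sDa aT]] :=
  infinitely_many_ex (@infinitely_many_noninvariant i)
    (finitely_many_or (finitely_many_sign_change i)
      (finitely_many_height m (Num.truncn T))).
have {}sDa : D (srefl B i a) by apply: contrapT => nD; apply: sDa.
have {}aT : T < (height a)%:~R.
  have lt : (Num.truncn T)%:Z < height a.
    by rewrite ltNge; apply/negP => le; apply: aT; split=> //; case: Da => -[].
  have T0 : 0 <= T by rewrite divr_ge0 // mulr_ge0 // ltW.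
  apply: lt_le_trans (truncnS_gt _) _.
  move: lt; move: (Num.truncn T) => t lt.
  rewrite -[t.+1%:R]/((t.+1%:Z)%:~R) ler_int.
  by rewrite -lezD1 in lt; move: lt; rewrite addrC.
apply: finitely_many_sub (finitely_many_or (CP _ Da) (CP _ sDa)) => g [Eg lt].
apply: contrapT => /not_orP [na nsa].
have hg : 0 < (height g)%:~R :> R by rewrite ltr0z (pos_root_height gcmB Eg.1).
have ha : 0 < (height a)%:~R :> R by rewrite ltr0z (pos_root_height gcmB Da.1).
have {}na : `|bf a g| * (height a)%:~R <= C * (height g)%:~R.
  by rewrite leNgt; apply/negP => h; apply: na.
have {}nsa : `|bf (srefl B i a) g| * (height (srefl B i a))%:~R <= C * (height g)%:~R.
  by rewrite leNgt; apply/negP => h; apply: nsa.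
have has : (height a)%:~R <= C2 * (height (srefl B i a))%:~R.
  by rewrite -{1}(sreflK gcmB i a); apply: C2P; case: sDa => -[].
have diff : bf a g - bf (srefl B i a) g = (p i a)%:~R * (d i * (p i g)%:~R).
  rewrite -root_formBl // /srefl opprB addrC subrK.
  by rewrite root_formZl root_form_simple.
have key : d i * `|(p i g)%:~R| * (height a)%:~R <= C3 * (height g)%:~R.
  apply: le_trans (_ : `|bf a g - bf (srefl B i a) g| * (height a)%:~R <= _).
    apply: ler_wpM2r; first exact: ltW.
    rewrite diff !normrM (gtr0_norm di0) ler_peMl //.
      by rewrite mulr_ge0 // ltW.
    by rewrite -intr_norm ler1z -gtz0_ge1 normr_gt0.
  apply: le_trans (ler_wpM2r (ltW ha) (ler_normB _ _)) _.
  rewrite /C3 mulrDr mulr1 !mulrDl; apply: lerD => //.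
  apply: le_trans (ler_wpM2l (normr_ge0 _) has) _.
  by rewrite mulrCA [C * _]mulrC -mulrA ler_pM2l.
move: key; apply/negP; rewrite -ltNge.
have : C3 < d i * eps * (height a)%:~R by rewrite mulrC -ltr_pdivrMr // mulr_gt0.
rewrite -(ltr_pM2r hg) => /lt_trans; apply.
by rewrite mulrAC ltr_pM2r // -mulrA ltr_pM2l.
Qed.

(** For each eps the infinite family E has a root outside the exceptional set of [small_pairing];
    these are the approximate kernel vectors that [simplex_kernel] asks for. *)
Lemma pos_root_limit : ~ finitely_many E -> exists v : 'rV[R]_m,
  [/\ forall j, 0 <= v 0 j, \sum_j v 0 j = 1,
      forall l, 0 <= (v *m map_mx intr M) 0 l & BR *m v^T = 0].
Proof.
move=> infE; apply: simplex_kernel => eps eps0.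
have [g [pg qg] small] := infinitely_many_ex infE (small_pairing eps0).
have hgE : \sum_j (map_mx intr g : 'rV[R]_m) 0 j = (height g)%:~R.
  by rewrite /height raddf_sum; apply: eq_bigr => j _; rewrite mxE.
exists (map_mx intr g); split=> [j||l|i].
- by rewrite mxE ler0z; case: pg.
- by rewrite hgE ltr0z (pos_root_height gcmB pg).
- by rewrite -map_mxM mxE ler0z; apply: qg.
- have -> : (BR *m (map_mx intr g)^T) i 0 = (p i g)%:~R.
    rewrite mxE cartan_pairing_row raddf_sum; apply: eq_bigr => j _.
    by rewrite !mxE /= intrM.
  by rewrite hgE leNgt; apply/negP => lt; apply: small; split=> //; exists i.
Qed.

End OneSide.

(** v has full support by [nneg_subharmonic]. Subtracting from w the largest multiple t v that keeps
    it nonnegative leaves a kernel vector with a zero coordinate, hence 0; comparing sums gives t =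
    1. *)
Lemma harmonic_unique (v w : 'rV[R]_m) :
  (forall j, 0 <= v 0 j) -> \sum_j v 0 j = 1 -> BR *m v^T = 0 ->
  (forall j, 0 <= w 0 j) -> \sum_j w 0 j = 1 -> BR *m w^T = 0 -> v = w.
Proof.
move=> v0 v1 Bv w0 w1 Bw.
have vT0 j : 0 <= v^T j 0 by rewrite mxE.
have sub (u : 'cV[R]_m) : BR *m u = 0 -> forall i, 0 <= (BR *m u) i 0.
  by move=> -> i; rewrite mxE.
have [i0 _|no] := pickP 'I_m; last first.
  by apply/rowP => i; have := no i.
have [vpos|vz] := nneg_subharmonic gcmB indB vT0 (fun i _ => sub _ Bv i); last first.
  have : \sum_j v 0 j = 0.
    by apply: big1 => j _; have /colP/(_ j) := vz; rewrite !mxE.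
  by rewrite v1 => /eqP; rewrite oner_eq0.
have [i imin] := min_ratio w^T i0 vpos; set t := _ / _ in imin.
pose u := w^T - t *: v^T.
have u0 j : 0 <= u j 0 by have := imin j; rewrite !mxE.
have Bu : BR *m u = 0 by rewrite mulmxBr -scalemxAr Bv Bw scaler0 subr0.
have ui : u i 0 = 0.
  have := vpos i; rewrite /u /t !mxE => vi.
  by rewrite divfK ?subrr // gt_eqF.
have [/(_ i)|uz] := nneg_subharmonic gcmB indB u0 (fun i _ => sub _ Bu i).
  by rewrite ui ltxx.
have wE j : w 0 j = t * v 0 j.
  by have /colP/(_ j) := uz; rewrite !mxE => /eqP; rewrite subr_eq0 => /eqP.
have t1 : t = 1.
  by rewrite -w1 -[LHS]mulr1 -v1 mulr_sumr; apply: eq_bigr => j _; rewrite wE.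
by apply/rowP => j; rewrite wE t1 mul1r.
Qed.

(** Were both families infinite, the limits for M and -M would agree by [harmonic_unique]; the image
    of this vector would be both nonnegative and nonpositive, hence 0, against the freeness of M. *)
Lemma embedding_dichotomy (M : 'M[int]_(m, n)) :
  root_embedding A B M -> row_free (map_mx intr M : 'M[R]_(m, n)) ->
  finitely_many (fun x => pos_root B x /\ nneg (- (x *m M))) \/
  finitely_many (fun x => pos_root B x /\ nneg (x *m M)).
Proof.
move=> embM freeM; apply: contrapT => /not_orP [infD infE].
have [v [v0 v1 vM Bv]] := pos_root_limit embM freeM infD infE.
have freeN : row_free (map_mx intr (- M) : 'M[R]_(m, n)).
  by rewrite map_mxN /row_free mxrank_opp.
have DN : (fun x => pos_root B x /\ nneg (- (x *m - M))) =
          (fun x => pos_root B x /\ nneg (x *m M)).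
  by apply/funext => x; rewrite mulmxN opprK.
have EN : (fun x => pos_root B x /\ nneg (x *m - M)) =
          (fun x => pos_root B x /\ nneg (- (x *m M))).
  by apply/funext => x; rewrite mulmxN.
have := pos_root_limit (root_embeddingN gcmA embM) freeN.
rewrite DN EN => /(_ infE infD) [w [w0 w1 wM Bw]].
have vw := harmonic_unique v0 v1 Bv w0 w1 Bw.
have vM0 : v *m map_mx intr M = 0.
  apply/rowP => l; apply/eqP; rewrite [X in _ == X]mxE eq_le vM andbT.
  by have := wM l; rewrite -vw map_mxN mulmxN mxE oppr_ge0.
have v_0 : v = 0 by apply: (row_free_inj freeM); rewrite vM0 mul0mx.
have : \sum_j v 0 j = 0 by apply: big1 => j _; rewrite v_0 mxE.
by rewrite v1 => /eqP; rewrite oner_eq0.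
Qed.

End Dichotomy.

(** * Linearly independent pi-systems *)

Lemma cartan_pairing_coact n (A : 'M[int]_n) (w : seq 'I_n) (c x : 'rV[int]_n) :
  gcm A -> cartan_pairing A (weyl_coact A w c) (weyl_act A w x) = cartan_pairing A c x.
Proof.
move=> gcmA; elim: w => //= i w <-.
rewrite /scorefl -/(weyl_coact A w c) -/(weyl_act A w x) /srefl -!scaleNr.
rewrite !cartan_pairingDl !cartan_pairingDr !cartan_pairingZl !cartan_pairingZr.
by rewrite cartan_pairing_simple gcm_diag //; ring.
Qed.

(** For b = w alpha_i the word represents w s_i w^-1. *)
Lemma coroot_reflection n (A : 'M[int]_n) (b c : 'rV[int]_n) :
  gcm A -> is_coroot A b c ->
  exists w, forall x, weyl_act A w x = x - cartan_pairing A c x *: b.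
Proof.
move=> gcmA [w [i [-> ->]]]; exists (w ++ i :: rev w) => x.
rewrite act_cat /= {1}/srefl actD -scaleNr actZ act_rev_inv // scaleNr.
by rewrite -(cartan_pairing_coact w _ _ gcmA) act_rev_inv.
Qed.

Lemma weyl_act_cone m n (A : 'M[int]_n) (M : 'M[int]_(m, n)) (w : seq 'I_n)
    (x : 'rV[int]_m) :
  (forall i, nneg (weyl_act A w (simple_root i *m M))) -> nneg x ->
  nneg (weyl_act A w (x *m M)).
Proof.
move=> wM x0; rewrite [x *m M]mulmx_sum_row.
elim/big_ind: _ => [|y z y0 z0 j|i _ j].
- by move=> j; rewrite -(scale0r 0) actZ scale0r mxE.
- by rewrite actD mxE addr_ge0.
- by rewrite actZ mxE rowE mulr_ge0 //; apply: wM.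
Qed.

Theorem theorem3p1 (R : realType) (n m : nat) (A : 'M[int]_n) (B : 'M[int]_m)
    (r : realization R A) (beta : 'I_m -> 'rV[int]_n) :
  gcm A -> symmetrizable A -> gcm B -> symmetrizable B ->
  pi_system r beta -> has_type A beta B -> lin_indep R beta ->
  indecomposable B ->
  (exists w : seq 'I_n,
     (forall i, real_root_pos A (weyl_act A w (beta i))) \/
     (forall i, real_root_neg A (weyl_act A w (beta i)))) /\
  ((exists w1 w2 : seq 'I_n,
      (forall i, real_root_pos A (weyl_act A w1 (beta i))) /\
      (forall i, real_root_neg A (weyl_act A w2 (beta i)))) <->
   finite_type R B).
Proof.
move=> gcmA _ gcmB symB [_ real_beta _] [s [c [coroot_c typeB]]] free_beta indB.
(* Reindexing by the inverse of s aligns the roots with the indices of B. *)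
pose M : 'M[int]_(m, n) := \matrix_(i < m) beta ((s^-1)%g i).
have eM i : simple_root (s i) *m M = beta i by rewrite -rowE rowK permK.
have eMV i : simple_root i *m M = beta ((s^-1)%g i) by rewrite -rowE rowK.
have freeM : row_free (map_mx intr M : 'M[R]_(m, n)).
  rewrite -(row_free_map (real_complex R)) -map_mx_comp.
  move: free_beta; rewrite /lin_indep; set N := \matrix_(i, j) _ => freeN.
  have -> : map_mx (real_complex R \o intr) M = perm_mx (s^-1)%g *m N.
    by rewrite -row_permE; apply/matrixP => i j; rewrite !mxE /= rmorph_int.
  by rewrite /row_free (eqmxMfull _ _) ?row_full_unit ?unitmx_perm.
have injM : injective (mulmx^~ M : 'rV[int]_m -> 'rV[int]_n).
  move=> x y xy; have : map_mx intr x = map_mx intr y :> 'rV[R]_m.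
    by apply: (row_free_inj freeM); rewrite -!map_mxM xy.
  by move=> /matrixP E; apply/matrixP => i j; have := E i j; rewrite !mxE => /intr_inj.
have embM : root_embedding A B M.
  split=> // i; first by rewrite eMV; apply: real_beta.
  have [w wE] := coroot_reflection gcmA (coroot_c ((s^-1)%g i)); exists w => x.
  rewrite wE /srefl mulmxBl -scalemxAl eMV; congr (_ - _ *: _).
  (* By linearity in x, the type condition identifies the pairing of the coroot with x M in A and
     that of alpha_i^vee with x in B. *)
  rewrite cartan_pairing_row mulmx_sum_row.
  elim/big_ind2: _ => [|? ? ? ? -> ->|j _].
  - by rewrite /cartan_pairing trmx0 mulmx0 mxE.
  - by rewrite cartan_pairingDr.
  - by rewrite cartan_pairingZr rowK -typeB !permKV mulrC.
have [d symd] := symmetrizable_symmetrizer R symB.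
have pos_word : finitely_many (fun x => pos_root B x /\ nneg (- (x *m M))) ->
    exists w, forall i, real_root_pos A (weyl_act A w (beta i)).
  move=> /(finite_inversions_conjugate gcmA gcmB embM) [w wM]; exists w => i.
  by split; [apply: act_real_root | rewrite -eM; apply: wM].
have neg_word : finitely_many (fun x => pos_root B x /\ nneg (x *m M)) ->
    exists w, forall i, real_root_neg A (weyl_act A w (beta i)).
  move=> finE.
  have [|w wM] := finite_inversions_conjugate gcmA gcmB (root_embeddingN gcmA embM).
    by apply: finitely_many_sub finE => x; rewrite mulmxN opprK.
  exists w => i; split=> [|j]; first exact: act_real_root.
  by have := wM (s i) j; rewrite mulmxN actN eM mxE oppr_ge0.
split.
  have [/pos_word [w wP]|/neg_word [w wP]] :=
    embedding_dichotomy gcmA gcmB symd indB embM freeM; exists w; by [left|right].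
split=> [[w1 [w2 [pos1 neg2]]]|finB]; last first.
  have fin := finite_type_pos_roots gcmB symd finB.
  have [|w1 pos1] := pos_word; first by apply: finitely_many_sub fin => x [].
  have [|w2 neg2] := neg_word; first by apply: finitely_many_sub fin => x [].
  by exists w1, w2.
have cone1 x : nneg x -> nneg (weyl_act A w1 (x *m M)).
  by apply: weyl_act_cone => i; rewrite eMV; case: (pos1 ((s^-1)%g i)).
have cone2 x : nneg x -> nneg (- weyl_act A w2 (x *m M)).
  move=> x0; rewrite -actN -mulmxN; apply: weyl_act_cone x0 => i j.
  by rewrite mulmxN eMV actN mxE oppr_ge0; case: (neg2 ((s^-1)%g i)).
(* w1 sends every positive root of B to a positive root of A, which w2 w1^-1 then inverts; so the
   positive roots of B inject into a finite inversion set. *)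
have fin : finitely_many (pos_root B).
  have inj1 : injective (fun x : 'rV[int]_m => weyl_act A w1 (x *m M)).
    by move=> x y /(act_inj gcmA) /injM.
  apply: finitely_many_sub (finitely_many_inj inj1
    (finitely_many_inversions gcmA (w2 ++ rev w1))) => x [rx x0].
  rewrite act_cat act_revK //; split; last exact: cone2.
  split; last exact: cone1.
  by apply: act_real_root; apply: (embedding_real_root embM).
have [u uP] := finite_pos_roots_dominant gcmB fin.
apply: (finite_type_of_positive gcmB indB (u := (map_mx intr u)^T)) => i.
  by rewrite !mxE ltr0z; case: (uP i).
have -> : (map_mx intr B *m (map_mx intr u)^T) i 0 =
    (cartan_pairing B (simple_root i) u)%:~R :> R.
  rewrite mxE cartan_pairing_row raddf_sum; apply: eq_bigr => j _.
  by rewrite !mxE /= intrM.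
by rewrite ltr0z; case: (uP i).
Qed.
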